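(* Let $a\in L^{N/2}(\mathbb{R}^N)$, $a\ge 0$, $a\ne 0$, $\lim_{|x|\to\infty}a(x)=0$, and let $b\in L^{\infty}(\mathbb{R}^N)$, $b\ge 0$, $b\ne 0$, $\lim_{|x|\to\infty}b(x)=0$. Then the map $\lambda\in\mathbb{R}^+\mapsto m_\lambda$ is continuous.
   Context: $N\ge 2$ is an integer; $p>1$, and $p<\frac{N+2}{N-2}$ if $N\ge 3$; $a_\infty>0$ and $b_\infty>0$ are constants; $\mathbb{R}^+=[0,+\infty)$. On $H^1(\mathbb{R}^N)$, $$I_\lambda(u)=\frac12\int_{\mathbb{R}^N}|\nabla u|^2+(a_\infty+\lambda a(x))u^2-\frac1{p+1}\int_{\mathbb{R}^N}(b_\infty+b(x))|u|^{p+1},$$ $\mathcal{N}_\lambda=\{u\in H^1(\mathbb{R}^N)\setminus\{0\}: I_\lambda'(u)[u]=0\}$, and $m_\lambda=\inf\{I_\lambda(u):u\in\mathcal{N}_\lambda\}$. *)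

(* Defs.v *)
From HB Require Import structures.
From mathcomp Require Import all_boot all_order all_algebra.
From mathcomp Require Import all_classical all_reals all_analysis.

Set Implicit Arguments.
Unset Strict Implicit.
Unset Printing Implicit Defensive.

Import Order.TTheory GRing.Theory Num.Theory.
Import numFieldNormedType.Exports.

Local Open Scope classical_set_scope.
Local Open Scope ring_scope.

Definition rV_display : measure_display.
Proof. exact: default_measure_display. Qed.

(* R^n is 'rV[R]_n.  Its sigma-algebra is generated by the coordinates, so it
   is the Borel one; the topology is the library's, on the same type. *)
Section measurable_rV.
Context (R : realType) (n : nat).

Let coor (i : 'I_n) (x : 'rV[R]_n) : measurableTypeR R := x ord0 i.

Let rV_set0 : g_sigma_preimage coor set0.
Proof. exact: sigma_algebra0. Qed.

Let rV_setC A : g_sigma_preimage coor A -> g_sigma_preimage coor (~` A).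
Proof. exact: sigma_algebraC. Qed.

Let rV_bigcup (F : (set 'rV[R]_n)^nat) :
  (forall i, g_sigma_preimage coor (F i)) ->
  g_sigma_preimage coor (\bigcup_i (F i)).
Proof. exact: sigma_algebra_bigcup. Qed.

HB.instance Definition _ := @isMeasurable.Build rV_display 'rV[R]_n
  (g_sigma_preimage coor) rV_set0 rV_setC rV_bigcup.

Lemma measurable_coor (i : 'I_n) :
  measurable_fun [set: 'rV[R]_n] (fun x : 'rV[R]_n => x ord0 i).
Proof.
move=> _ Y mY; rewrite setTI; apply: sub_sigma_algebra => /=.
rewrite -bigcup_seq/=; exists i => /=; first by rewrite mem_index_enum.
by exists Y => //; rewrite setTI.
Qed.

Lemma measurable_fun_rV d (T : measurableType d) (f : T -> 'rV[R]_n) :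
  (forall i, measurable_fun [set: T] (fun t => f t ord0 i)) ->
  measurable_fun [set: T] f.
Proof.
move=> mf _ Y mY; rewrite setTI.
suff : g_sigma_preimage coor `<=` [set A | measurable (f @^-1` A)] by exact.
apply: smallest_sub.
  split => [|A mA|F mF] /=.
  - by rewrite preimage_set0.
  - by rewrite setTD preimage_setC; exact: measurableC.
  - by rewrite preimage_bigcup; exact: bigcupT_measurable.
move=> A; rewrite -bigcup_seq => -[i _] /= [B mB <-] /=.
rewrite setTI -comp_preimage -[X in measurable X]setTI.
exact: (mf i measurableT B mB).
Qed.

End measurable_rV.

Section lebesgue_rV.
Context (R : realType).

Definition rV_cons n (p : measurableTypeR R * 'rV[R]_n) : 'rV[R]_n.+1 :=
  row_mx (p.1%:M : 'rV[R]_1) p.2.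

Lemma rV_cons0 n p : @rV_cons n p ord0 ord0 = p.1.
Proof.
rewrite /rV_cons.
have -> : ord0 = lshift n (ord0 : 'I_1) by exact: val_inj.
by rewrite (row_mxEl (p.1%:M : 'rV[R]_1)) mxE eqxx mulr1n.
Qed.

Lemma rV_consS n p (i : 'I_n) : @rV_cons n p ord0 (lift ord0 i) = p.2 ord0 i.
Proof.
rewrite /rV_cons.
have -> : lift ord0 i = rshift 1 i by exact: val_inj.
by rewrite (row_mxEr (p.1%:M : 'rV[R]_1)).
Qed.

Lemma measurable_rV_cons n : measurable_fun setT (@rV_cons n).
Proof.
apply: measurable_fun_rV => i.
case: (unliftP ord0 i) => [j ->|->].
  under eq_fun do rewrite rV_consS.
  by apply: (measurableT_comp (@measurable_coor R n j)); exact: measurable_snd.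
under eq_fun do rewrite rV_cons0.
exact: measurable_fst.
Qed.

Definition rV_uncons n (x : 'rV[R]_n.+1) : measurableTypeR R * 'rV[R]_n :=
  (x ord0 ord0, \row_i x ord0 (lift ord0 i)).

Lemma rV_consK n : cancel (@rV_cons n) (@rV_uncons n).
Proof.
move=> p; rewrite /rV_uncons rV_cons0 [RHS]surjective_pairing; congr pair.
by apply/rowP => i; rewrite mxE rV_consS.
Qed.

Lemma rV_unconsK n : cancel (@rV_uncons n) (@rV_cons n).
Proof.
move=> x; apply/rowP => i; case: (unliftP ord0 i) => [j ->|->].
  by rewrite rV_consS mxE.
by rewrite rV_cons0.
Qed.

Lemma measurable_rV_uncons n : measurable_fun setT (@rV_uncons n).
Proof.
apply: measurable_fun_pair => /=; first exact: (@measurable_coor R n.+1 ord0).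
apply: measurable_fun_rV => i.
under eq_fun do rewrite mxE.
exact: (@measurable_coor R n.+1).
Qed.

Section step.
Context (n : nat) (m : {sigma_finite_measure set 'rV[R]_n -> \bar R}).

Definition lebesgue_rVS : set 'rV[R]_n.+1 -> \bar R :=
  pushforward (@lebesgue_measure R \x m)%E (@rV_cons n).

HB.instance Definition _ := Measure.copy lebesgue_rVS
  (measure_function_pushforward__canonical__measure_function_Measure
    (@lebesgue_measure R \x m)%E (@measurable_rV_cons n)).

Let sigma_finite_lebesgue_rVS : sigma_finite setT lebesgue_rVS.
Proof.
have /sigma_finiteP[F [TF ndF Foo]] := sigma_finiteT (@lebesgue_measure R).
have /sigma_finiteP[G [TG ndG Goo]] := sigma_finiteT m.
exists (fun i => @rV_uncons n @^-1` (F i `*` G i)).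
  rewrite -preimage_bigcup; apply/esym; rewrite -subTset => x _ /=.
  have [i _ Fi] : (\bigcup_k F k) (rV_uncons x).1 by rewrite -TF.
  have [j _ Gj] : (\bigcup_k G k) (rV_uncons x).2 by rewrite -TG.
  exists (maxn i j) => //; split.
    by apply: subsetPset Fi; apply/ndF/leq_maxl.
  by apply: subsetPset Gj; apply/ndG/leq_maxr.
move=> i; have [mF lF] := Foo i; have [mG lG] := Goo i; split.
  rewrite -[X in measurable X]setTI.
  by apply: measurable_rV_uncons => //; exact: measurableX.
rewrite /lebesgue_rVS /pushforward -comp_preimage.
rewrite (_ : @rV_uncons n \o @rV_cons n = id); last first.
  by apply/funext => p /=; rewrite rV_consK.
by rewrite preimage_id product_measure1E// lte_mul_pinfty// ge0_fin_numE.
Qed.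

HB.instance Definition _ := Measure_isSigmaFinite.Build _ _ _ lebesgue_rVS
  sigma_finite_lebesgue_rVS.

End step.

Fixpoint lebesgue_rV n : {sigma_finite_measure set 'rV[R]_n -> \bar R} :=
  match n with
  | 0 => dirac (0 : 'rV[R]_0)
  | n'.+1 => lebesgue_rVS (lebesgue_rV n')
  end.

End lebesgue_rV.

Section sobolev.
Context (R : realType) (N : nat).
Implicit Types (u v g phi : 'rV[R]_N -> R) (x : 'rV[R]_N) (i : 'I_N).

Let mu := @lebesgue_rV R N.

(* The library's norm on 'rV[R]_N is the sup norm. *)
Definition enorm x : R := Num.sqrt (\sum_(i < N) x ord0 i ^+ 2).

Definition cvg0_at_infinity u :=
  forall e : R, 0 < e -> exists r : R,
    {ae mu, forall x, r < enorm x -> `|u x| < e}.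

Definition partial i phi : 'rV[R]_N -> R := 'D_(delta_mx ord0 i) phi.

Definition iter_partial (s : seq 'I_N) phi := foldr partial phi s.

Definition smooth phi := forall s : seq 'I_N,
  continuous (iter_partial s phi) /\
  forall i x, derivable (iter_partial s phi) x (delta_mx ord0 i).

Definition test_function phi :=
  smooth phi /\ compact (closure [set x | phi x != 0]).

Definition weak_partial i u g := forall phi, test_function phi ->
  \int[mu]_x (u x * partial i phi x) = - \int[mu]_x (g x * phi x).

(* Elements of H^1 are represented by functions, not by their classes modulo
   equality almost everywhere. *)
Definition H1 : set ('rV[R]_N -> R) :=
  [set u | u \in Lfun mu 2%:E /\
    forall i, exists2 g, g \in Lfun mu 2%:E & weak_partial i u g].

(* For u in H^1, the weak derivative, determined up to a null set. *)
Definition wgrad u i : 'rV[R]_N -> R :=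
  get [set g | g \in Lfun mu 2%:E /\ weak_partial i u g].

Section functional.
Context (p ainf binf : R) (a b : 'rV[R]_N -> R).

(* Rintegral returns 0 when an integral of a nonnegative function diverges.
   This can affect only the first integral (when a u^2 is not integrable, e.g.
   for N = 2), and such a u never satisfies the Nehari condition below: the
   functional then reduces to its second term, whose derivative along u does
   not vanish. *)
Definition energy (lambda : R) u : R :=
  2^-1 * \int[mu]_x ((\sum_(i < N) wgrad u i x ^+ 2)
                     + (ainf + lambda * a x) * u x ^+ 2)
  - (p + 1)^-1 * \int[mu]_x ((binf + b x) * `|u x| `^ (p + 1)).

Definition has_energy_derivative (lambda : R) u v (l : R) :=
  is_derive (0 : R) (1 : R)
    (fun t : R => energy lambda (fun x => u x + t * v x)) l.

Definition nehari (lambda : R) : set ('rV[R]_N -> R) :=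
  [set u | [/\ H1 u, ~ (u = cst 0 %[ae mu])
             & has_energy_derivative lambda u u 0]].

Definition ground_level (lambda : R) : R :=
  inf [set energy lambda u | u in nehari lambda].

End functional.

End sobolev.

(* Main.v *)
(* For u in H^1 put G = int |grad u|^2 + ainf u^2, A = int a u^2, B = int (binf + b)
   |u|^(p+1). Along a ray the Nehari condition reads G + l A = B, so m_l is the infimum
   over u of theta ((G + l A) / B)^(2/(p-1)) (G + l A), with theta = 1/2 - 1/(p+1). Each
   of these functions of l is nondecreasing, and since G + k A >= (k / l) (G + l A) for
   k <= l, so is m_l, with m_k >= (k / l)^((p+1)/(p-1)) m_l; this gives continuity at
   positive l. At l = 0 the infimum also runs over functions with A = oo, which are
   replaced by averages over small cubes: these are bounded, hence have A < oo, do not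
   increase G, and almost do not decrease B. The same averages make the Sobolev
   embedding unnecessary: if some u in H^1 had A = B = oo, then m_l would vanish for all
   l. *)
Require Import Defs.
From HB Require Import structures.
From mathcomp Require Import all_boot all_order all_algebra.
From mathcomp Require Import all_classical all_reals all_analysis.
From mathcomp Require Import measurable_realfun ess_sup_inf.
From mathcomp Require Import ring lra.
Set Implicit Arguments.
Unset Strict Implicit.
Unset Printing Implicit Defensive.
Import Order.TTheory GRing.Theory Num.Theory.
Import numFieldNormedType.Exports.
Local Open Scope classical_set_scope.
Local Open Scope ring_scope.

(** * Lebesgue measure on R^N *)

Section rV_measure.
Context {R : realType}.

(** [wgrad] is an arbitrary choice among weak derivatives, so [Gf] of an average can be computed
    only once weak derivatives are known to be unique almost everywhere. This is why the density of
    bump functions in L^2 is proved; the same density yields continuity of translations, hence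
    convergence of the averages. Cube averages are preferred to smooth mollifiers because only
    boundedness, L^2 contraction and commutation with weak derivatives are asked of the
    approximants. The energy is real-valued and counts divergent integrals as 0, so the identities
    along rays are proved for extended-real integrals and then passed through [fine], infinite
    values included. At l = 0 the factor (k / l)^((p+1)/(p-1)) gives nothing, but monotonicity
    already bounds m_l below by m_0; one near-minimiser of m_0 with A finite then gives the upper
    bound for all small l. Since [inf] of the empty set is 0, comparisons of levels require nonempty
    Nehari sets, and emptiness is a case of its own. *)

Lemma lebesgue_measure_translation (c : R) (A : set R) : measurable A ->
  pushforward (@lebesgue_measure R) (fun x => x + c : measurableTypeR R) A =
  @lebesgue_measure R A.
Proof.
move=> mA.
have mc : measurable_fun setT (fun x : measurableTypeR R => x + c : measurableTypeR R).
  by apply: measurable_funD.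
apply/esym.
apply: (@lebesgue_measure_unique R
  (measure_function_pushforward__canonical__measure_function_Measure
    (@lebesgue_measure R) mc)) => //= _ [[a b]] _ <-.
rewrite /pushforward.
have -> : (fun x => x + c) @^-1` `]a, b]%classic = `]a - c, b - c]%classic.
  by apply/seteqP; split => x /=; rewrite !in_itv/= ltrBlDr lerBrDr.
rewrite !lebesgue_measure_itv/= !lte_fin ltrD2r; case: ifPn => // _.
by congr (_%:E); rewrite opprD addrACA subrr addr0.
Qed.

Lemma integral_translation1 (c : R) (f : R -> \bar R) :
  measurable_fun setT f -> (forall x, 0 <= f x)%E ->
  (\int[@lebesgue_measure R]_x f (x + c)%R = \int[@lebesgue_measure R]_x f x)%E.
Proof.
move=> mf f0.
have mc : measurable_fun setT (fun x : measurableTypeR R => x + c : measurableTypeR R).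
  by apply: measurable_funD.
rewrite -[LHS](@ge0_integral_pushforward _ _ _ _ _ _ mc (@lebesgue_measure R) setT f)//.
by apply: eq_measure_integral => A mA _; exact: lebesgue_measure_translation.
Qed.

Lemma integral_rVS n (f : 'rV[R]_n.+1 -> \bar R) :
  measurable_fun setT f -> (forall x, 0 <= f x)%E ->
  (\int[lebesgue_rV R n.+1]_x f x =
   \int[@lebesgue_measure R]_s \int[lebesgue_rV R n]_z f (rV_cons (s, z)))%E.
Proof.
move=> mf f0.
have := @ge0_integral_pushforward _ _ _ _ _ _ (@measurable_rV_cons R n)
  (@lebesgue_measure R \x lebesgue_rV R n)%E setT f measurableT mf (fun x _ => f0 x).
rewrite preimage_setT => E; rewrite [LHS]E fubini_tonelli1//.
  by apply: measurableT_comp mf _; exact: measurable_rV_cons.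
by move=> x /=; exact: f0.
Qed.

Lemma measurable_add_rV n (y : 'rV[R]_n) : measurable_fun setT (fun x : 'rV[R]_n => x +
  y).
Proof.
apply: measurable_fun_rV => i; under eq_fun do rewrite mxE.
by apply: measurable_funD => //; exact: measurable_coor.
Qed.

(** Induction on the dimension: Tonelli separates the first coordinate, the remaining ones are
    shifted by the induction hypothesis and the first by the one-dimensional case. *)
Lemma integral_translation n (y : 'rV[R]_n) (f : 'rV[R]_n -> \bar R) :
  measurable_fun setT f -> (forall x, 0 <= f x)%E ->
  (\int[lebesgue_rV R n]_x f (x + y)%R = \int[lebesgue_rV R n]_x f x)%E.
Proof.
elim: n y f => [|n IH] y f mf f0.
  by apply: eq_integral => x _; rewrite (thinmx0 y) addr0.
have mfy : measurable_fun setT (fun x : 'rV[R]_n.+1 => f (x + y)).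
  by apply: measurableT_comp mf (measurable_add_rV y).
rewrite !integral_rVS//.
pose F s := (\int[lebesgue_rV R n]_z f (rV_cons (s, z)))%E.
have mF : measurable_fun setT F.
  apply: (@measurable_fun_fubini_tonelli_F _ _ _ _ _ (lebesgue_rV R n) (f \o @rV_cons R
    n)).
    by apply: measurableT_comp mf _; exact: measurable_rV_cons.
  by move=> x /=; exact: f0.
transitivity (\int[@lebesgue_measure R]_s F (s + y ord0 ord0)%R)%E; last first.
  by apply: integral_translation1 => // s; apply: integral_ge0.
apply: eq_integral => s _; rewrite /F.
have mfs : measurable_fun setT (fun z => f (rV_cons (s + y ord0 ord0, z))).
  apply: (measurable_fun_pair2 (T1 := measurableTypeR R) (f := f \o @rV_cons R n)).
  by apply: measurableT_comp mf _; exact: measurable_rV_cons.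
rewrite -(IH (\row_i y ord0 (lift ord0 i)) _ mfs)//.
apply: eq_integral => z _; congr f; apply/rowP => i.
case: (unliftP ord0 i) => [j ->|->]; first by rewrite mxE !rV_consS !mxE.
by rewrite mxE !rV_cons0.
Qed.

Lemma measurable_box n (B : 'I_n -> set R) : (forall i, measurable (B i)) ->
  measurable [set x : 'rV[R]_n | forall i, B i (x ord0 i)].
Proof.
move=> mB.
have -> : [set x : 'rV[R]_n | forall i, B i (x ord0 i)] =
    \bigcap_(i in [set: 'I_n]) ((fun x : 'rV[R]_n => x ord0 i) @^-1` B i).
  by apply/seteqP; split => x /= h i; [move=> _; exact: h|exact: (h i I)].
apply: fin_bigcap_measurable => // i _.
by rewrite -[X in measurable X]setTI; exact: measurable_coor.
Qed.

Lemma lebesgue_rV_cube n (B : set R) : measurable B ->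
  lebesgue_rV R n [set x | forall i, B (x ord0 i)] =
  ((@lebesgue_measure R B) ^+ n)%E.
Proof.
move=> mB; elim: n => [|n IH].
  rewrite /= diracE.
  by rewrite mem_set//= => -[].
rewrite /= /lebesgue_rVS /pushforward.
have -> : @rV_cons R n @^-1` [set x | forall i, B (x ord0 i)] =
    B `*` [set x : 'rV[R]_n | forall i, B (x ord0 i)].
  apply/seteqP; split => -[s z] /= h.
    split; first by have := h ord0; rewrite rV_cons0.
    by move=> i; have := h (lift ord0 i); rewrite rV_consS.
  move=> i; case: (unliftP ord0 i) => [j ->|->]; first by rewrite rV_consS; apply: h.2.
  by rewrite rV_cons0; exact: h.1.
rewrite product_measure1E//; last exact: (measurable_box (fun=> mB)).
by rewrite IH; exact: (esym (expeS _ _)).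
Qed.

(** The sigma-algebra is generated by coordinates, so open sets must first be shown measurable: each
    is the union of the countably many cubes [C q k], with rational centre [q] and half-side
    [1/(k+1)], that it contains. *)
Lemma continuous_measurable_rV n (f : 'rV[R]_n -> R) :
  continuous f -> measurable_fun setT f.
Proof.
move=> cf.
have mO (U : set 'rV[R]_n) : open U -> measurable U.
  move=> oU.
  pose qv (q : 'rV[rat]_n) : 'rV[R]_n := map_mx ratr q.
  pose I q k i := `](qv q) ord0 i - k.+1%:R^-1, (qv q) ord0 i + k.+1%:R^-1[%classic.
  pose C q k := [set x : 'rV[R]_n | forall i, I q k i (x ord0 i)].
  have mC q k : measurable (C q k).
    exact: (@measurable_box _ (I q k) (fun i => measurable_itv _)).
  have -> : U = \bigcup_(j in [set j : nat | exists q k, unpickle j = Some (q, k) /\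
    C q k `<=` U])
       (if @unpickle ('rV[rat]_n * nat)%type j is Some (q, k) then C q k else set0).
    apply/seteqP; split=> [x Ux|x [j [q [k [-> /= h]]]]]; last exact: h.
    have /nbhs_ballP[e /= e0 eU] : nbhs x U by move: oU; rewrite openE => /(_ _ Ux).
    (* A rational centre within [1/(k+1)] of [x] in each coordinate gives a cube containing [x], all
       of whose points are within [2/(k+1) < e] of [x] in the sup norm. *)
    have [k ke] : exists k, k.+1%:R^-1 < e / 2.
      have [k _ kP] := near_infty_natSinv_lt (PosNum (divr_gt0 e0 (ltr0n _ 2))).
      by exists k; apply: (kP k) => /=.
    have /choice[q qP] (i : 'I_n) : exists r : rat,
       ratr r \in `]x ord0 i - k.+1%:R^-1, x ord0 i + k.+1%:R^-1[.
      apply: rat_in_itvoo.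
      by rewrite ltrD2l; apply: (@lt_trans _ _ 0); rewrite ?oppr_lt0 ?invr_gt0.
    exists (pickle (\row_i q i, k)) => /=; last first.
      rewrite pickleK => i; move: (qP i); rewrite /I !mxE /= !in_itv/=.
      by move: (k.+1%:R^-1 : R) => r /andP[? ?]; apply/andP; split; lra.
    exists (\row_i q i), k; rewrite pickleK; split => // z zC.
    apply: eU; split => // i j; rewrite (ord1 i).
    move: (qP j) (zC j) ke; rewrite /I /= !in_itv/= !mxE.
    move: (k.+1%:R^-1 : R) => r /andP[? ?] /andP[? ?] ?.
    by rewrite /ball/= ltr_norml; apply/andP; split; lra.
  apply: bigcup_measurable => j _.
  by case: (unpickle j) => [[q k]|].
apply: (measurability _ (RGenOpens.measurableE R)).
move=> _ [_ [a [b ->] <-]].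
rewrite setTI; apply: mO.
by move/continuousP: cf; apply; exact: interval_open.
Qed.

End rV_measure.

(** * Smooth bump functions *)

Section flat_function.
Context {R : realType}.
Implicit Types (c x : R) (n : nat).

(* All derivatives of [exp (- c / x)] on the half line are combinations of these
   functions, which vanish to infinite order at 0. *)
Definition flat c n x : R := if 0 < x then x^-1 ^+ n * expR (- (c * x^-1)) else 0.

Lemma is_derive_congr (f g : R -> R) x l l' :
  is_derive x 1 f l -> f =1 g -> l = l' -> is_derive x 1 g l'.
Proof. by move=> df /funext <- <-. Qed.

Lemma flat_ge0 c n x : 0 <= flat c n x.
Proof.
rewrite /flat; case: ifPn => // x0.
by rewrite mulr_ge0 ?expR_ge0// exprn_ge0// invr_ge0 ltW.
Qed.

Lemma flatS c n x : flat c n x = x * flat c n.+1 x.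
Proof.
rewrite /flat; case: ifPn => [x0|_]; last by rewrite mulr0.
by rewrite exprS !mulrA divff ?gt_eqF// mul1r.
Qed.

Lemma flat_bounded c n : 0 < c -> exists2 C, 0 < C & forall x, flat c n x <= C.
Proof.
(* With [s = 1/x], the exponential series bounds [s ^ n.+1 * expR (- (c * s))] by the first summand,
   which suffices when [s >= 1]; the summand 1 covers [s <= 1]. *)
move=> c0; exists (n.+1`!%:R / c ^+ n.+1 + 1).
  by rewrite addr_gt0// divr_gt0// ?exprn_gt0// ltr0n fact_gt0.
move=> x; rewrite /flat; case: ifPn => [x0|_]; last first.
  by rewrite addr_ge0// divr_ge0// exprn_ge0// ltW.
set s := x^-1; have s0 : 0 < s by rewrite invr_gt0.
rewrite expRN; have e0 := expR_gt0 (c * s).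
rewrite ler_pdivrMr//.
have h1 : (c * s) ^+ n.+1 / n.+1`!%:R <= expR (c * s).
  apply: le_trans (expR_ge1Dxn n (mulr_ge0 (ltW c0) (ltW s0))).
  by rewrite lerDr.
have f0 : 0 < (n.+1`!%:R : R) by rewrite ltr0n fact_gt0.
have h2 : s ^+ n.+1 <= n.+1`!%:R / c ^+ n.+1 * expR (c * s).
  rewrite mulrAC ler_pdivlMr ?exprn_gt0// mulrC -exprMn.
  by rewrite [leRHS]mulrC -ler_pdivrMr.
have h3 : 1 <= expR (c * s) by rewrite -expR0 ler_expR mulr_ge0 // ltW.
rewrite mulrDl mul1r; have [s1|s1] := leP s 1.
  apply: (@le_trans _ _ 1); first by rewrite exprn_ile1// ltW.
  apply: le_trans h3 _; rewrite lerDr mulr_ge0 // ?ltW // divr_gt0 // exprn_gt0 //.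
apply: (@le_trans _ _ (s ^+ n.+1)); first by rewrite ler_eXn2l.
by apply: le_trans h2 _; rewrite lerDl ltW.
Qed.

Lemma is_derive_flat c n x : 0 < c ->
  is_derive x 1 (flat c n) (- n%:R * flat c n.+1 x + c * flat c n.+2 x).
Proof.
move=> c0; have [x0|x0|->] := ltgtP x 0.
- rewrite /flat ltNge (ltW x0)/= !mulr0 addr0.
  apply: (@near_eq_is_derive _ _ _ (cst 0)).
  near=> y; rewrite ltNge ltW//; near: y; exact: lt_nbhsl.
- rewrite {2 3}/flat x0.
  apply: (@near_eq_is_derive _ _ _ (fun x => x^-1 ^+ n * expR (- (c * x^-1)))).
    near=> y; rewrite /flat ifT//; near: y; exact: lt_nbhsr.
  have xn0 : x != 0 by rewrite gt_eqF.
  have d1 : is_derive x 1 (fun y : R => y^-1) (- x ^- 2 *: 1).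
    by apply: is_deriveV.
  have d2 := @is_deriveX _ _ _ n x 1 _ d1.
  have d3 : is_derive x 1 (fun y : R => - (c * y^-1)) (- (c *: (- x ^- 2 *: 1))).
    by apply: is_deriveN; exact: is_deriveZ.
  have d4 := @is_derive1_comp _ expR (fun y : R => - (c * y^-1)) x _ _ _ d3.
  apply: is_derive_congr (is_deriveM d2 (d4 _ (is_derive_expR _))) _ _.
    by move=> y; rewrite !fctE.
  rewrite !fctE /GRing.scale/= !mulr1 /=.
  case: n {d2} => [|n]; rewrite ?exprS ?expr0 /=; first by rewrite !mul0r; field.
  by rewrite -mulr_natr; field.
- have flat0 m : flat c m 0 = 0 by rewrite /flat ltxx.
  (* The difference quotient at 0 is [flat c n t / t = t * flat c n.+2 t], and the last factor is
     bounded. *)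
  have [C C0 CP] := @flat_bounded c n.+2 c0.
  have h : (fun h : R => h^-1 *: ((flat c n \o shift 0) (h *: 1) - flat c n 0)) @ 0^' -->
    (0 : R).
    apply/cvgr0Pnorm_lt => e e0; near=> t => /=.
    have t0 : t != 0 by near: t; exact: nbhs_dnbhs_neq.
    rewrite addr0 /GRing.scale/= mulr1 flat0 subr0 (flatS c n) (flatS c n.+1).
    rewrite (mulrA t^-1) mulVf// mul1r normrM (ger0_norm (flat_ge0 _ _ _)).
    apply: (@le_lt_trans _ _ (`|t| * C)); first by rewrite ler_wpM2l.
    rewrite -ltr_pdivlMr//.
    near: t; apply: dnbhs0_lt; exact: divr_gt0.
  rewrite !flat0 !mulr0 addr0; apply: DeriveDef; last exact/cvg_lim.
  by apply/cvg_ex; exists 0.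
Unshelve. all: by end_near. Qed.

End flat_function.

(** * Compactly supported products of one-dimensional bumps *)

Section bumps.
Context {R : realType}.

(* Stable under differentiation, so differentiability of its members already gives
   smoothness. *)
Inductive bump1 (c a b : R) : (R -> R) -> Prop :=
| bump1_base n m : bump1 c a b (fun x => flat c n (x - a) * flat c m (b - x))
| bump1D f g : bump1 c a b f -> bump1 c a b g -> bump1 c a b (f \+ g)
| bump1Z k f : bump1 c a b f -> bump1 c a b (fun x => k * f x).

Lemma bump1_out c a b f : bump1 c a b f -> forall x, x \notin `[a, b] -> f x = 0.
Proof.
elim=> [n m|g h _ IHg _ IHh|k g _ IHg] x xab /=.
- move: xab; rewrite in_itv/= negb_and -!ltNge => /orP[xa|bx].
    by rewrite /flat ltNge subr_le0 (ltW xa) mul0r.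
  by rewrite mulrC /flat ltNge subr_le0 (ltW bx) mul0r.
- by rewrite IHg// IHh// addr0.
- by rewrite IHg// mulr0.
Qed.

Lemma bump1_derive c a b f : 0 < c -> bump1 c a b f ->
  exists2 f', bump1 c a b f' & forall x : R, is_derive x 1 f (f' x).
Proof.
move=> c0; elim=> [n m|g h _ [g' Bg' dg'] _ [h' Bh' dh']|k g _ [g' Bg' dg']].
- exists (fun x => (- n%:R * (flat c n.+1 (x - a) * flat c m (b - x)) +
     c * (flat c n.+2 (x - a) * flat c m (b - x))) +
     (m%:R * (flat c n (x - a) * flat c m.+1 (b - x)) +
     - c * (flat c n (x - a) * flat c m.+2 (b - x)))).
    by repeat first [apply: bump1D|apply: bump1Z|apply: bump1_base].
  move=> x.
  have d1 : is_derive x 1 (fun x => flat c n (x - a)) (1 *: (- n%:R * flat c n.+1 (x - a)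
    + c * flat c n.+2 (x - a))).
    apply: is_derive_congr (@is_derive1_comp _ (flat c n) (shift (- a)) x _ _
      (is_derive_flat n (x - a) c0) (is_derive_shift _ _ _)) _ _ => //.
    by rewrite /GRing.scale/=; ring.
  have d2 : is_derive x 1 (fun x => flat c m (b - x)) (- (- m%:R * flat c m.+1 (b - x) +
    c * flat c m.+2 (b - x))).
    have d : is_derive x 1 (fun x => b - x) (- 1 : R).
      apply: is_derive_congr (is_deriveB (is_derive_cst b x 1) (is_derive_id x
        1)) _ _ => //.
      by rewrite sub0r.
    apply: is_derive_congr (@is_derive1_comp _ (flat c m) (fun x => b - x) x _ _
      (is_derive_flat m (b - x) c0) d) _ _ => //.
    by rewrite /GRing.scale/=; ring.
  apply: is_derive_congr (is_deriveM d1 d2) _ _ => //.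
  by rewrite /GRing.scale/=; ring.
- exists (g' \+ h') => [|x]; first exact: bump1D.
  exact: is_deriveD.
- exists (fun x => k * g' x) => [|x]; first exact: bump1Z.
  exact: is_deriveZ.
Qed.

Lemma bump1_continuous c a b f : 0 < c -> bump1 c a b f -> continuous f.
Proof.
move=> c0 Bf x; have [f' _ /(_ x)[+ _]] := bump1_derive c0 Bf.
by move=> /derivable1_diffP/differentiable_continuous.
Qed.

Context {N : nat}.
Implicit Types (a b : 'I_N -> R) (i : 'I_N).

(** Sums are confined to the one-dimensional factors: a partial derivative changes a single factor,
    so the product form survives differentiation. *)
Definition bump c a b (f : 'rV[R]_N -> R) := exists2 fs : 'I_N -> R -> R,
  (forall i, bump1 c (a i) (b i) (fs i)) & f = (fun x => \prod_i fs i (x ord0 i)).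

Lemma bump_partial c a b f i : 0 < c -> bump c a b f ->
  (forall x, derivable f x (delta_mx ord0 i)) /\ bump c a b (partial i f).
Proof.
move=> c0 [fs Bfs ->].
have [fi' Bfi' dfi'] := bump1_derive c0 (Bfs i).
pose K (x : 'rV[R]_N) := \prod_(j | j != i) fs j (x ord0 j).
pose P (x : 'rV[R]_N) := \prod_j fs j (x ord0 j).
have lim_ x : (fun h : R => h^-1 *: ((P \o shift x) (h *: delta_mx ord0 i) - P x)) @ 0^'
  --> fi' (x ord0 i) * K x.
  have -> : (fun h : R => h^-1 *: ((P \o shift x) (h *: delta_mx ord0 i) - P x)) =
     (fun h : R => (h^-1 *: ((fs i \o shift (x ord0 i)) (h *: 1) - fs i (x ord0 i))) * K
       x).
    apply/funext => h /=; rewrite /P (bigD1 i)//= [in X in _ - X](bigD1 i)//=.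
    rewrite !mxE !eqxx mulr1 -[RHS]scalerAl; congr (_ *: _).
    rewrite mulrBl; congr (fs i _ * _ - _); first by rewrite /GRing.scale/= mulr1.
    apply: eq_bigr => j ji; rewrite !mxE (negbTE ji) andbF.
    by rewrite mulr0 add0r.
  apply: cvgMl => //.
  by have [d <-] := dfi' (x ord0 i); exact: d.
split=> [x|]; first by apply/cvg_ex; eexists; exact: lim_.
exists (fun j => if j == i then fi' else fs j).
  by move=> j; case: eqVneq => [->|].
apply/funext => x; rewrite (bigD1 i)//= eqxx.
rewrite [X in _ * X](_ : _ = K x); last by apply: eq_bigr => j /negbTE ->.
by rewrite /partial /derive; apply/cvg_lim => //; exact: lim_.
Qed.

Lemma bump_continuous c a b f : 0 < c -> bump c a b f -> continuous f.
Proof.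
move=> c0 [fs Bfs ->].
suff H (s : seq 'I_N) : continuous (fun x : 'rV[R]_N => \prod_(i <- s) fs i (x ord0 i)).
  exact: H.
elim: s => [|i s IH].
  rewrite (_ : (fun _ => _) = cst 1); first exact: cst_continuous.
  by apply/funext => x; rewrite big_nil.
rewrite (_ : (fun _ => _) = (fun x : 'rV[R]_N => fs i (x ord0 i)) \* (fun x =>
  \prod_(j <- s) fs j (x ord0 j))); last first.
  by apply/funext => x; rewrite big_cons.
move=> x; apply: continuousM; last exact: IH.
apply: (@continuous_comp _ _ _ (fun x : 'rV[R]_N => x ord0 i) (fs i));
  first exact: coord_continuous.
exact: (bump1_continuous c0 (Bfs i)).
Qed.

Lemma bump_test c a b f : 0 < c -> bump c a b f -> test_function f.
Proof.
move=> c0 Bf; split.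
  move=> s; have Bs : bump c a b (iter_partial s f).
    by elim: s => [//|i s IH] /=; exact: (bump_partial i c0 IH).2.
  split; first exact: bump_continuous Bs.
  by move=> i x; exact: (bump_partial i c0 Bs).1.
have cK : compact [set x : 'rV[R]_N | forall i, x ord0 i \in `[a i, b i]].
  apply: (@rV_compact _ _ (fun i => `[a i, b i]%classic)) => i.
  exact: segment_compact.
apply: (subclosed_compact _ cK); first exact: closed_closure.
rewrite closureE; apply: smallest_sub.
  by apply: compact_closed => //; exact: norm_hausdorff.
case: Bf => fs Bfs -> x /= fx0 i; apply/negPn/negP => xi; move/negP: fx0; apply.
by apply/eqP; rewrite (bigD1 i)//= (bump1_out (Bfs i))// mul0r.
Qed.

End bumps.

(** * Square-integrable functions *)

Section square_integrable.
Context d (T : measurableType d) (R : realType) (mu : {measure set T -> \bar R}).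
Implicit Types f g h : T -> R.

Definition sqint f :=
  measurable_fun setT f /\ (\int[mu]_x (f x ^+ 2)%:E < +oo)%E.

Lemma sqintP f : f \in Lfun mu 2%:E <-> sqint f.
Proof.
split=> [fL|[mf foo]].
  split; first by move: fL; rewrite inE => /andP[]; rewrite inE.
  have /integrableP[_] := Lfun2_integrable_sqr fL.
  by under eq_integral do rewrite /= ger0_norm ?sqr_ge0//.
rewrite inE; apply/andP; split; first by rewrite inE.
rewrite inE /= /finite_norm unlock/= poweR_lty//.
under eq_integral => x _ do rewrite powR_mulrn// -normrX ger0_norm ?sqr_ge0//.
exact: foo.
Qed.

Lemma sqint_integrable f : sqint f -> mu.-integrable setT (fun x => (f x ^+ 2)%:E).
Proof. by move=> /sqintP/Lfun2_integrable_sqr. Qed.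

Lemma sqint_mul f g : sqint f -> sqint g ->
  mu.-integrable setT (fun x => (f x * g x)%:E).
Proof.
by move=> /sqintP fL /sqintP gL; exact/Lfun1_integrable/Lfun2_mul_Lfun1.
Qed.

Lemma sqint_le f g : measurable_fun setT f -> sqint g ->
  (forall x, `|f x| <= `|g x|) -> sqint f.
Proof.
move=> mf [mg goo] fg; split => //; apply: le_lt_trans goo.
apply: ge0_le_integral => //.
- by move=> x _; rewrite lee_fin sqr_ge0.
- by apply/measurable_EFinP; exact: measurable_funX.
- by apply/measurable_EFinP; exact: measurable_funX.
- by move=> x _; rewrite lee_fin -[leLHS]real_normK ?num_real// -[leRHS]real_normK
  ?num_real// lerXn2r ?nnegrE.
Qed.

Lemma sqintZ k f : sqint f -> sqint (fun x => k * f x).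
Proof.
move=> [mf foo]; split; first exact: measurable_funM.
under eq_integral do rewrite exprMn EFinM.
rewrite ge0_integralZl_EFin ?sqr_ge0//.
- by rewrite lte_mul_pinfty// ?lee_fin ?sqr_ge0.
- by move=> x _; rewrite lee_fin sqr_ge0.
- by apply/measurable_EFinP; exact: measurable_funX.
Qed.

Lemma sqintD f g : sqint f -> sqint g -> sqint (fun x => f x + g x).
Proof.
move=> sf sg; have [mf _] := sf; have [mg _] := sg.
split; first exact: measurable_funD.
have /integrableP[_ h] := integrableD measurableT (integrableZl measurableT 2
  (sqint_integrable sf))
   (integrableZl measurableT 2 (sqint_integrable sg)).
apply: le_lt_trans h; apply: ge0_le_integral => //.
- by move=> x _; rewrite lee_fin sqr_ge0.
- by apply/measurable_EFinP; apply: measurable_funX; exact: measurable_funD.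
- apply: measurableT_comp => //; apply: emeasurable_funD => //; apply/measurable_EFinP;
  by apply: measurable_funM => //; exact: measurable_funX.
- move=> x _ /=; rewrite lee_fin ger0_norm; last first.
    by rewrite addr_ge0// mulr_ge0// sqr_ge0.
  by rewrite -subr_ge0; have := sqr_ge0 (f x - g x); nra.
Qed.

Lemma sqintB f g : sqint f -> sqint g -> sqint (fun x => f x - g x).
Proof.
move=> sf /(sqintZ (-1)) sg; have := sqintD sf sg.
by under eq_fun do rewrite mulN1r.
Qed.

Lemma sqint_norm f : sqint f -> sqint (fun x => `|f x|).
Proof.
move=> sf; apply: (sqint_le _ sf) => [|x]; last by rewrite normr_id.
by apply: measurableT_comp => //; exact: sf.1.
Qed.

Lemma sqint_indic A : measurable A -> (mu A < +oo)%E -> sqint (\1_A : T -> R).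
Proof.
move=> mA Aoo; split; first exact: measurable_indic.
rewrite (eq_integral (fun x => (\1_A x)%:E)); last first.
  by move=> x _; rewrite indicE; case: (x \in A); rewrite /= ?expr0n ?expr1n.
by rewrite integral_indic// setIT.
Qed.

Lemma sqint_eq0 f : sqint f -> \int[mu]_x (f x ^+ 2) = 0 -> f = cst 0 %[ae mu].
Proof.
move=> sf f0.
have : (\int[mu]_x `|(f x ^+ 2)%:E| = 0)%E.
  under eq_integral do rewrite /= ger0_norm ?sqr_ge0//.
  by rewrite -[LHS]fineK -?/(Rintegral _ _ _) ?f0//;
    exact: (integrable_fin_num _ (sqint_integrable sf)).
move/(ae_eq_integral_abs mu measurableT) => h.
have /h : measurable_fun setT (fun x => (f x ^+ 2)%:E).
  by apply/measurable_EFinP; apply: measurable_funX; exact: sf.1.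
apply: filterS => x /(_ I) [/eqP]; rewrite sqrf_eq0 => /eqP fx _; exact: fx.
Qed.

(** Both [f_ n] and [f] are bounded by [g], so [4 * g ^+ 2] dominates the squared differences. *)
Lemma dominated_sq (f_ : nat -> T -> R) f g :
  (forall n, measurable_fun setT (f_ n)) -> sqint g ->
  (forall n x, `|f_ n x| <= g x) -> (forall x, f_ ^~ x @ \oo --> f x) ->
  sqint f /\ (fun n => \int[mu]_x ((f_ n x - f x) ^+ 2)) @ \oo --> (0 : R).
Proof.
move=> mf_ sg fg ff.
have mf : measurable_fun setT f by apply: (measurable_fun_cvg (h := f_)) => // x _;
  exact: ff.
have fgx x : `|f x| <= g x.
  by apply: (cvgr_to_le (cvg_norm (ff x))); apply: nearW => n; exact: fg.
have sf : sqint f.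
  by apply: (sqint_le mf sg) => x; apply: le_trans (fgx x) (ler_norm _).
split => //.
have := @dominated_convergence _ _ _ mu setT measurableT
  (fun n x => ((f_ n x - f x) ^+ 2)%:E) (cst 0%E) (fun x => (4 * (g x) ^+ 2)%:E).
case.
- move=> n; apply/measurable_EFinP; apply: measurable_funX.
  exact: measurable_funB.
- exact: measurable_cst.
- apply: aeW => x _; apply: cvg_EFin; first exact: nearW.
  rewrite [X in _ --> X](_ : _ = 0 ^+ 2); last by rewrite expr0n.
  rewrite /comp/=.
  suff h : (fun n => f_ n x - f x) @ \oo --> (0 : R) by apply: cvgM.
  by rewrite -(subrr (f x)); apply: cvgB; [exact: ff|exact: cvg_cst].
- exact: (integrableZl measurableT 4 (sqint_integrable sg)).
- apply: aeW => x n _ /=; rewrite lee_fin ger0_norm ?sqr_ge0//.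
  have := fg n x; have := fgx x; rewrite !ler_norml => /andP[? ?] /andP[? ?].
  by rewrite -subr_ge0 (_ : 4 * _ - _ = (2 * g x - (f_ n x - f x)) * (2 * g x +
    (f_ n x - f x))); [apply: mulr_ge0; lra|ring].
- by move=> _ _; rewrite integral0 => /fine_cvg; exact: cvg_trans.
Qed.

End square_integrable.

Section sq_norm.
Context d (T : measurableType d) (R : realType) (mu : {measure set T -> \bar R}).
Implicit Types f g : T -> R.

(** The square of the L^2 norm. Working with squares avoids roots, at the price of [nrm2D] with its
    factors 2 in place of the triangle inequality. *)
Definition nrm2 f := \int[mu]_x (f x ^+ 2).

Lemma nrm2_ge0 f : 0 <= nrm2 f.
Proof. by apply: Rintegral_ge0 => x _; exact: sqr_ge0. Qed.

Lemma nrm2E f : sqint mu f -> (\int[mu]_x (f x ^+ 2)%:E = (nrm2 f)%:E)%E.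
Proof.
move=> sf; rewrite fineK//.
exact: (integrable_fin_num measurableT (sqint_integrable sf)).
Qed.

Lemma nrm2Z k f : sqint mu f -> nrm2 (fun x => k * f x) = k ^+ 2 * nrm2 f.
Proof.
move=> sf; rewrite /nrm2 -RintegralZl//; last exact: sqint_integrable.
by apply: eq_Rintegral => x _; rewrite exprMn.
Qed.

Lemma nrm2D f g : sqint mu f -> sqint mu g ->
  nrm2 (fun x => f x + g x) <= 2 * nrm2 f + 2 * nrm2 g.
Proof.
move=> sf sg.
have i1 : mu.-integrable setT (fun x => (2 * f x ^+ 2)%:E).
  exact: (integrableZl measurableT 2 (sqint_integrable sf)).
have i2 : mu.-integrable setT (fun x => (2 * g x ^+ 2)%:E).
  exact: (integrableZl measurableT 2 (sqint_integrable sg)).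
rewrite /nrm2 -(RintegralZl _ measurableT (sqint_integrable sf))//.
rewrite -(RintegralZl _ measurableT (sqint_integrable sg))//.
rewrite -RintegralD//; apply: le_Rintegral => //.
- exact: (sqint_integrable (sqintD sf sg)).
- exact: (integrableD measurableT i1 i2).
- by move=> x _; rewrite -subr_ge0; have := sqr_ge0 (f x - g x); nra.
Qed.

End sq_norm.

(** * Density of bump functions in L^2 *)

Section density.
Context {R : realType} (N : nat).
Let mu := lebesgue_rV R N.

Definition cube (r : R) : set 'rV[R]_N := [set x | forall i, x ord0 i \in `]- r, r[].

Lemma measurable_cubeE r : measurable (cube r).
Proof. exact: (measurable_box (fun i : 'I_N => measurable_itv `]- r, r[)). Qed.

Lemma cube_lty r : (mu (cube r) < +oo)%E.
Proof.
rewrite /mu (lebesgue_rV_cube N (measurable_itv `]- r, r[)).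
rewrite lebesgue_measure_itv /=; case: ifP => _; last by case: N => [|n];
  rewrite ?expe0 ?ltry// expeS mul0e.
by rewrite -EFinD -EFin_expe ltry.
Qed.

Lemma sqint_cube r : sqint mu (\1_(cube r) : 'rV[R]_N -> R).
Proof. by apply: sqint_indic; [exact: measurable_cubeE|exact: cube_lty]. Qed.

Definition obox (a b : 'I_N -> R) : set 'rV[R]_N :=
  [set x | forall i, x ord0 i \in `]a i, b i[].

(** Upper orthants are stable under intersection, by coordinatewise maxima, as Dynkin's theorem
    requires of a generating family. *)
Definition upset (a : 'I_N -> R) : set 'rV[R]_N := [set x | forall i, a i < x ord0 i].

Lemma measurable_upset a : measurable (upset a).
Proof.
have -> : upset a = [set x | forall i, `]a i, +oo[%classic (x ord0 i)].
  by apply/seteqP; split => x /= h i; have := h i; rewrite in_itv/= andbT.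
exact: (@measurable_box _ _ (fun i => `]a i, +oo[%classic) (fun i => measurable_itv _)).
Qed.

(** A half-space bounding one coordinate below is the increasing union of orthants whose other
    coordinates are bounded below by [- n]. *)
Lemma upset_generates :
  @measurable _ 'rV[R]_N = <<s [set upset a | a in [set: 'I_N -> R]] >>.
Proof.
apply/seteqP; split; last first.
  by apply: smallest_sub; [exact: sigma_algebra_measurable|move=> _ [a _ <-];
    exact: measurable_upset].
apply: smallest_sub; first exact: smallest_sigma_algebra.
move=> A; rewrite -bigcup_seq => -[i _] /= [B mB <-] /=; rewrite setTI.
set G := [set upset a | a in _].
suff : @measurable _ (measurableTypeR R) `<=` [set B | <<s G >> ((fun x : 'rV[R]_N =>
  x ord0 i) @^-1` B)] by apply.
rewrite [X in X `<=` _]RGenOInfty.measurableE.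
apply: smallest_sub.
  split => [|C mC|F mF] /=.
  - rewrite preimage_set0; exact: sigma_algebra0.
  - rewrite setTD preimage_setC; exact: sigma_algebraC.
  - rewrite preimage_bigcup; exact: sigma_algebra_bigcup.
move=> _ [c ->] /=.
have -> : (fun x : 'rV[R]_N => x ord0 i) @^-1` `]c, +oo[%classic =
   \bigcup_n upset (fun j => if j == i then c else - n%:R).
  apply/seteqP; split => [x|x [n _ xn]] /=; rewrite in_itv/= andbT.
    move=> cx; have [n xn] : exists n : nat, \sum_j `|x ord0 j| < n%:R.
      exists (Num.truncn (\sum_j `|x ord0 j|)).+1.
      exact: truncnS_gt.
    exists n => // j; case: eqVneq => [->//|_].
    apply: (@lt_le_trans _ _ (- `|x ord0 j|)); last by rewrite lerNl -normrN ler_norm.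
    rewrite ltrN2; apply: le_lt_trans xn; rewrite (bigD1 j)//= lerDl.
    by apply: sumr_ge0.
  by have := xn i; rewrite eqxx.
apply: sigma_algebra_bigcup => n; apply: sub_sigma_algebra.
by eexists.
Qed.

Lemma flat_le1 (c : R) x : 0 <= c -> flat c 0 x <= 1.
Proof.
move=> c0; rewrite /flat; case: ifPn => // x0; rewrite expr0 mul1r.
by rewrite expR_le1 oppr_le0 mulr_ge0// invr_ge0 ltW.
Qed.

(** As the parameter tends to 0, [flat _ 0] tends to the indicator of the positive half-line;
    products of such functions then tend to indicators of open boxes. *)
Lemma flat_cvg1 (x : R) : 0 < x -> flat k.+1%:R^-1 0 x @[k --> \oo] --> (1 : R).
Proof.
move=> x0; rewrite /flat x0.
under eq_cvg do rewrite expr0 mul1r.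
suff : expR (- (k.+1%:R^-1 * x^-1)) @[k --> \oo] --> expR (0 : R) by rewrite expR0.
apply: continuous_cvg; first exact: continuous_expR.
rewrite -[X in _ --> X]oppr0 -[in X in _ --> X](mul0r (x^-1)); apply: cvgN; apply: cvgMl.
exact: cvg_harmonic.
Qed.

(* A set of functions containing the bump functions and stable under linear combinations
   and dominated limits contains L^2: its indicators form a Dynkin system generating the
   Borel sets. *)
Variable W : set ('rV[R]_N -> R).
Hypothesis Wlin : forall k f g, W f -> W g -> W (fun x => k * f x + g x).
Hypothesis Wbump : forall c a b f, 0 < c -> bump c a b f -> W f.
Hypothesis Wlim : forall (f_ : nat -> 'rV[R]_N -> R) f g, (forall n, W (f_ n)) ->
  sqint mu g -> (forall n x, `|f_ n x| <= g x) ->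
  (forall x, f_ ^~ x @ \oo --> f x) -> W f.

Let W0 : W (cst 0).
Proof.
(* Any bump function [f] serves here: the zero function is [- f + f]. *)
pose f (x : 'rV[R]_N) := \prod_i (flat 1 0 (x ord0 i - 0) * flat 1 0 (0 - x ord0 i)) : R.
have Wf : W f.
  apply: (@Wbump 1 (fun=> 0) (fun=> 0)) => //.
  by exists (fun=> fun t => flat 1 0 (t - 0) * flat 1 0 (0 - t)) => // i;
    exact: bump1_base.
have := Wlin (-1) Wf Wf.
by rewrite (_ : (fun _ => _) = cst 0)//; apply/funext => x; rewrite mulN1r addNr.
Qed.

Let WZ k f : W f -> W (fun x => k * f x).
Proof. by move=> Wf; have := Wlin k Wf W0; under eq_fun do rewrite addr0. Qed.

Let WD f g : W f -> W g -> W (fun x => f x + g x).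
Proof. by move=> Wf Wg; have := Wlin 1 Wf Wg; under eq_fun do rewrite mul1r. Qed.

Let Wsum (I : Type) (s : seq I) (F : I -> 'rV[R]_N -> R) :
  (forall i, W (F i)) -> W (fun x => \sum_(i <- s) F i x).
Proof.
move=> WF; elim: s => [|i s IH].
  by rewrite (_ : (fun _ => _) = cst 0)//; apply/funext => x; rewrite big_nil.
by under eq_fun do rewrite big_cons; exact: WD.
Qed.

(** The bounds by [r] put the box inside [cube r], whose indicator is the square-integrable
    dominating function. *)
Let W_obox a b r : (forall i, - r <= a i) -> (forall i, b i <= r) -> W \1_(obox a b).
Proof.
move=> ar br.
pose f k (x : 'rV[R]_N) : R := \prod_i (flat k.+1%:R^-1 0 (x ord0 i - a i) * flat
  k.+1%:R^-1 0 (b i - x ord0 i)).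
have fout k x : x \notin obox a b -> f k x = 0.
  rewrite notin_setE => nx; have [i /negP xi] : exists i, ~ x ord0 i \in `]a i, b i[.
    by apply/not_existsP => h; apply: nx => i; apply: contrapT; exact: h.
  rewrite /f (bigD1 i)//=; move: xi; rewrite in_itv/= negb_and -!leNgt.
  case/orP => h.
    by rewrite {1}/flat ltNge subr_le0 h/= !mul0r.
  by rewrite {2}/flat ltNge subr_le0 h/= mulr0 mul0r.
apply: (Wlim (f_ := f) (g := \1_(cube r))).
- move=> k; apply: (@Wbump k.+1%:R^-1 a b) => //.
  by exists (fun i t => flat k.+1%:R^-1 0 (t - a i) * flat k.+1%:R^-1 0 (b i - t)) => //
    i; exact: bump1_base.
- exact: sqint_cube.
- move=> k x; case: (boolP (x \in obox a b)) => [xo|/fout ->]; last by rewrite normr0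
  indicE.
  rewrite indicE mem_set/=; last first.
    move=> i; move: xo; rewrite inE => /(_ i); rewrite !in_itv/= => /andP[h1 h2].
    by rewrite (le_lt_trans (ar i))//= (lt_le_trans h2).
  rewrite /f ger0_norm; last by apply: prodr_ge0 => i _; rewrite mulr_ge0 ?flat_ge0.
  apply: prodr_ile1 => i _; rewrite mulr_ge0 ?flat_ge0//=.
  by rewrite mulr_ile1 ?flat_ge0 ?flat_le1.
- move=> x; case: (boolP (x \in obox a b)) => [xo|xo]; last first.
    rewrite indicE (negbTE xo); under eq_cvg do rewrite (fout _ _ xo).
    exact: cvg_cst.
  rewrite indicE xo/=.
  rewrite [X in _ --> X](_ : _ = \prod_(i < N) (1 * 1 : R)); last by rewrite big1// => i;
    rewrite mul1r.
  apply: cvg_big; first by exact: mul_continuous.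
  move=> i _; move: xo; rewrite inE => /(_ i); rewrite !in_itv/= => /andP[h1 h2].
  by apply: cvgM; apply: flat_cvg1; rewrite subr_gt0.
Qed.

Let W_cube r : W \1_(cube r).
Proof. by apply: (@W_obox (fun=> - r) (fun=> r) r). Qed.

(** Intersecting with [cube r] keeps all indicators below one square-integrable function, so that
    disjoint unions can be reached through dominated limits of their finite parts; complements are
    differences from [\1_(cube r)]. *)
Let W_indic r A : measurable A -> W \1_(A `&` cube r).
Proof.
move=> mA.
apply: (dynkin_induction upset_generates (P := fun A => W \1_(A `&` cube r)));
  last by rewrite -upset_generates.
- move=> _ _ [a _ <-] [b _ <-]; exists (fun i => Num.max (a i) (b i)) => //.
  apply/seteqP; split => x /=.
    by move=> h; split => i; have := h i; rewrite gt_max => /andP[].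
  by move=> [h1 h2] i; rewrite gt_max h1 h2.
- by rewrite setTI; exact: W_cube.
- move=> _ [a _ <-].
  rewrite (_ : _ `&` _ = obox (fun i => Num.max (a i) (- r)) (fun=> r)).
    by apply: (W_obox (r := r)) => // i; rewrite le_max lexx orbT.
  apply/seteqP; split => x /=.
    by move=> [h1 h2] i; have := h2 i; rewrite !in_itv/= gt_max h1.
  by move=> h; split => i; have := h i; rewrite !in_itv/= gt_max => /andP[/andP[? ?] ?]//;
    apply/andP.
- move=> S mS WS; have := Wlin (-1) WS (W_cube r).
  rewrite (_ : (fun _ => _) = \1_(~` S `&` cube r))//; apply/funext => x.
  rewrite !indicE !in_setI in_setC.
  by case: (x \in S); case: (x \in cube r); rewrite /= ?mulr1 ?mulr0 ?addNr ?add0r.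
- move=> F mF tF WF.
  have WU n : W \1_((\big[setU/set0]_(i < n) F i) `&` cube r).
    elim: n => [|n IH].
      rewrite big_ord0 set0I (_ : \1_set0 = cst 0)//.
      by apply/funext => x; rewrite indicE in_set0.
    have := WD IH (WF n); rewrite (_ : (fun _ => _) = \1_((\big[setU/set0]_(i < n.+1) F i)
      `&` cube r))//.
    apply/funext => x; rewrite big_ord_recr/= !indicE !in_setI in_setU.
    case: (boolP (x \in F n)) => xn; last by rewrite orbF /= addr0.
    rewrite (_ : x \in \big[setU/set0]_(i < n) F i = false)/= ?add0r//.
    apply/negbTE; rewrite notin_setE -bigcup_mkord => -[i /= ilt xi].
    have := tF i n I I; move: xn; rewrite inE => xn /(_ (ex_intro _ x (conj xi xn))) iE.
    by rewrite iE ltnn in ilt.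
  apply: (Wlim WU (sqint_cube r)) => [n x|x].
    by rewrite !indicE in_setI ger0_norm// ler_nat; case: (x \in cube r);
      rewrite ?andbF ?andbT ?leq_b1.
  apply: cvg_near_cst.
  case: (boolP (x \in \bigcup_k F k)) => [|xF].
    rewrite inE => -[k _ xk]; near=> n.
    rewrite !indicE !in_setI; congr ((_ && _)%:R).
    rewrite [RHS]mem_set; last by exists k.
    rewrite mem_set// -bigcup_mkord; exists k => //=; near: n; exact: nbhs_infty_gt.
  apply: nearW => n; rewrite !indicE !in_setI (negbTE xF); congr ((_ && _)%:R).
  apply/negbTE; apply: contra xF; rewrite !inE -bigcup_mkord => -[i _ xi]; by exists i.
Unshelve. all: by end_near. Qed.

Import HBNNSimple.

Let W_ge0 f : sqint mu f -> (forall x, 0 <= f x) -> W f.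
Proof.
move=> sf f0; have mf : measurable_fun setT (EFin \o f) by apply/measurable_EFinP;
  exact: sf.1.
pose h := nnsfun_approx measurableT mf.
(* Simple functions cut off to growing cubes are finite combinations of the indicators of [W_indic],
   and [f] itself dominates them. *)
pose f_ n (x : 'rV[R]_N) := h n x * \1_(cube n%:R) x.
have hf (x : 'rV[R]_N) : (h n x) @[n --> \oo] --> f x.
  have := @cvg_nnsfun_approx _ _ _ _ measurableT _ mf (fun x _ => f0 x) x I.
  by move=> /fine_cvg.
have hle n (x : 'rV[R]_N) : h n x <= f x.
  rewrite -lee_fin.
  have := @cvg_nnsfun_approx _ _ _ _ measurableT _ mf (fun x _ => f0 x) x I.
  move=> hc; have nd : nondecreasing_seq (fun n => (h n x)%:E).
    by move=> m k mk; rewrite lee_fin; exact/lefP/nd_nnsfun_approx.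
  have -> : (f x)%:E = ereal_sup (range (fun n => (h n x)%:E)).
    transitivity (limn (fun n => (h n x)%:E)); first exact/esym/cvg_lim.
    by apply/cvg_lim => //; exact: ereal_nondecreasing_cvgn.
  by apply: ereal_sup_ubound; exists n.
apply: (Wlim (f_ := f_) (g := f)) => //.
- move=> n; rewrite /f_.
  under eq_fun do rewrite fimfunE fsbig_finite//= big_distrl/=.
  apply: Wsum => y.
  rewrite (_ : (fun _ => _) = (fun x => y * \1_((h n @^-1` [set y]) `&` cube n%:R) x)).
    by apply/WZ/W_indic.
  by apply/funext => x; rewrite !indicE in_setI -mulrA -natrM mulnb.
- move=> n x; rewrite /f_ indicE ger0_norm ?mulr_ge0//.
  by case: (x \in _); rewrite ?mulr1 ?mulr0.
- move=> x; rewrite -[X in _ --> X]mulr1; apply: cvgM; first exact: hf.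
  apply: cvg_near_cst; near=> n.
  rewrite indicE mem_set// => i.
  have : \sum_j `|x ord0 j| < n%:R.
    by near: n; exact: nbhs_infty_gtr.
  rewrite (bigD1 i)//= => xn; rewrite in_itv/= -ltr_norml; apply: le_lt_trans xn.
  by rewrite lerDl sumr_ge0.
Unshelve. all: by end_near. Qed.

Lemma density f : sqint mu f -> W f.
Proof.
move=> sf.
have sp : sqint mu (fun x => Num.max (f x) 0).
  apply: (sqint_le _ sf) => [|x]; first by apply: measurable_maxr => //; exact: sf.1.
  by rewrite /Num.max; case: ltP => h //; rewrite normr0.
have sn : sqint mu (fun x => Num.max (- f x) 0).
  apply: (sqint_le _ sf) => [|x]; first by apply: measurable_maxr => //;
    apply: measurable_funN; exact: sf.1.
  by rewrite /Num.max; case: ltP => h; rewrite ?normr0 ?normrN.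
have max0 (t : R) : 0 <= Num.max t 0 by rewrite le_max lexx orbT.
have wp := W_ge0 sp (fun x => max0 (f x)); have wn := W_ge0 sn (fun x => max0 (- f x)).
have := Wlin (-1) wn wp; rewrite (_ : (fun _ => _) = f)//.
apply/funext => x; rewrite /Num.max; case: ltP => h1; case: ltP => h2; lra.
Qed.

End density.

(** * Test functions and weak derivatives *)

Section test_functions.
Context {R : realType} {N : nat}.
Let mu := lebesgue_rV R N.
Implicit Types (phi : 'rV[R]_N -> R) (i : 'I_N).

Lemma partial_smooth i phi : smooth phi -> smooth (partial i phi).
Proof. by move=> sphi s; have := sphi (rcons s i); rewrite /iter_partial foldr_rcons. Qed.

Lemma partial_support i phi :
  [set x | partial i phi x != 0] `<=` closure [set x | phi x != 0].
Proof.
move=> x /= px0; apply: contrapT => nx.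
have o : open (~` closure [set x | phi x != 0]).
  by rewrite openC; exact: closed_closure.
have : \near x, phi x = cst 0 x.
  move: o; rewrite openE => /(_ x nx); apply: filterS => z nz.
  apply/eqP/negPn/negP => pz; apply: nz; exact: subset_closure.
move=> /near_eq_derive E; move: px0.
by rewrite /partial (E (delta_mx ord0 i)) derive_cst eqxx.
Qed.

Lemma test_partial i phi : test_function phi -> test_function (partial i phi).
Proof.
move=> [sphi cphi]; split; first exact: partial_smooth.
apply: (subclosed_compact _ cphi); first exact: closed_closure.
rewrite [X in X `<=` _]closureE; apply: smallest_sub; first exact: closed_closure.
exact: partial_support.
Qed.

Lemma test_continuous phi : test_function phi -> continuous phi.
Proof. by move=> [/(_ [::])[]]. Qed.

Lemma test_dominated phi : test_function phi -> exists M r,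
  0 <= M /\ forall x, `|phi x| <= M * \1_(cube r) x.
Proof.
move=> tphi; have [_ cphi] := tphi.
have [r [_ rP]] := compact_bounded cphi.
have [M [_ MP]] : bounded_set [set `|phi x| | x in closure [set x | phi x != 0]].
  apply: compact_bounded; apply: continuous_compact => //.
  apply: continuous_subspaceT => x; apply: continuous_comp; first exact: test_continuous.
  exact: norm_continuous.
(* [compact_bounded] provides every bound strictly above [M] or [r], hence [M + 1] and [r + 1]; the
   cube is open, hence [r + 2]. *)
exists (Num.max (M + 1) 0), (Num.max (r + 2) 0); split; first by rewrite le_max lexx orbT.
move=> x; have [->|px] := eqVneq (phi x) 0.
  by rewrite normr0 mulr_ge0// le_max lexx orbT.
have cx : closure [set x | phi x != 0] x by exact: subset_closure.
rewrite indicE mem_set ?mulr1.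
  have : `|(`|phi x|)| <= M + 1 by apply: (MP (M + 1)); [rewrite ltrDl|exists x].
  by rewrite normr_id => h; rewrite le_max h.
move=> i; rewrite in_itv/= -ltr_norml.
have h : `|x| <= r + 1 by apply: (rP (r + 1)) => //; rewrite ltrDl.
apply: (@le_lt_trans _ _ `|x|).
  rewrite [leRHS]/Num.norm /= mx_normrE; apply: le_trans (le_bigmax _ _ (ord0, i)) => //=.
by rewrite lt_max; apply/orP; left; lra.
Qed.

Lemma test_sqint phi : test_function phi -> sqint mu phi.
Proof.
move=> tphi; have [M [r [M0 h]]] := test_dominated tphi.
apply: (sqint_le _ (sqintZ M (sqint_cube N r))).
  by apply: continuous_measurable_rV; exact: test_continuous.
by move=> x; apply: le_trans (h x) (ler_norm _).
Qed.

Lemma diff_quotient_shift i phi y x :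
  (fun h : R => h^-1 *: (((fun x => phi (x + y)) \o shift x) (h *: delta_mx ord0 i)
                         - phi (x + y))) =
  (fun h : R => h^-1 *: ((phi \o shift (x + y)) (h *: delta_mx ord0 i) - phi (x + y))).
Proof. by apply/funext => h /=; rewrite addrA. Qed.

Lemma partial_shift i phi y :
  partial i (fun x => phi (x + y)) = (fun x => partial i phi (x + y)).
Proof. by apply/funext => x; rewrite /partial /derive diff_quotient_shift. Qed.

Lemma iter_partial_shift s phi y :
  iter_partial s (fun x => phi (x + y)) = (fun x => iter_partial s phi (x + y)).
Proof. by elim: s => //= i s IH; rewrite IH partial_shift. Qed.

Lemma continuous_addr (y : 'rV[R]_N) : continuous (fun x : 'rV[R]_N => x + y).
Proof. by move=> x; apply: continuousD => //; exact: cst_continuous. Qed.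

Lemma test_shift phi y : test_function phi -> test_function (fun x => phi (x + y)).
Proof.
move=> [sphi cphi]; split.
  move=> s; rewrite iter_partial_shift; split.
    move=> x; apply: (@continuous_comp _ _ _ (fun x : 'rV[R]_N => x + y)).
      exact: continuous_addr.
    exact: (sphi s).1.
  move=> i x; have := (sphi s).2 i (x + y); rewrite /derivable.
  by rewrite diff_quotient_shift.
have : compact ((fun x : 'rV[R]_N => x - y) @` closure [set x | phi x != 0]).
  apply: continuous_compact => //; apply: continuous_subspaceT.
  exact: continuous_addr.
move=> cK; apply: (subclosed_compact _ cK); first exact: closed_closure.
rewrite [X in X `<=` _]closureE; apply: smallest_sub.
  by apply: compact_closed => //; exact: norm_hausdorff.
move=> x /= px; exists (x + y); last by rewrite addrK.
exact: subset_closure.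
Qed.

(** The difference [h] of the two derivatives is orthogonal to bump functions. Orthogonality passes
    to linear combinations and dominated limits, hence to all of L^2, and [h] is orthogonal to
    itself. *)
Lemma weak_partial_unique i (u g1 g2 : 'rV[R]_N -> R) :
  sqint mu g1 -> sqint mu g2 -> weak_partial i u g1 -> weak_partial i u g2 ->
  g1 = g2 %[ae mu].
Proof.
move=> s1 s2 w1 w2; pose h x := g1 x - g2 x.
have sh : sqint mu h by exact: sqintB.
have W : forall f, sqint mu f -> sqint mu f /\ \int[mu]_x (h x * f x) = 0.
  apply: density.
  - move=> k f g [sf f0] [sg g0]; split.
      by apply: sqintD => //; exact: sqintZ.
    rewrite (@eq_Rintegral _ _ _ mu setT (fun x => k * (h x * f x) + h x * g x));
      last first.
      by move=> x _; ring.
    rewrite RintegralD//; last 2 first.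
      exact: (integrableZl measurableT k (sqint_mul sh sf)).
      exact: sqint_mul.
    by rewrite RintegralZl ?f0 ?g0 ?mulr0 ?addr0//; exact: sqint_mul.
  - move=> c a b f c0 /bump_test - /(_ c0) tf; have sf := test_sqint tf.
    split => //.
    rewrite (@eq_Rintegral _ _ _ mu setT (fun x => g1 x * f x - g2 x * f x)); last first.
      by move=> x _; rewrite /h mulrBl.
    rewrite RintegralB//; last 2 first.
      exact: sqint_mul.
      exact: sqint_mul.
    by apply/eqP; rewrite subr_eq0 -eqr_opp -w1// -w2.
  - move=> f_ f g W sg fg ff.
    have mf_ n : measurable_fun setT (f_ n) by have [[]] := W n.
    have [sf _] := dominated_sq mf_ sg fg ff; split => //.
    have := @dominated_convergence _ _ _ mu setT measurableT
      (fun n x => (h x * f_ n x)%:E) (fun x => (h x * f x)%:E) (fun x =>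
        (`|h x| * g x)%:E).
    case.
    + by move=> n; apply/measurable_EFinP; apply: measurable_funM => //; exact: sh.1.
    + by apply/measurable_EFinP; apply: measurable_funM; [exact: sh.1|exact: sf.1].
    + apply: aeW => x _; apply: cvg_EFin; first exact: nearW.
      by apply: cvgMr; exact: ff.
    + by apply: sqint_mul => //; exact: sqint_norm.
    + by apply: aeW => x n _ /=; rewrite lee_fin normrM ler_wpM2l.
    + move=> _ _ hc; rewrite /Rintegral -(cvg_lim _ hc)//.
      rewrite (_ : [sequence _]_n = cst 0%E); first by rewrite lim_cst.
      apply/funext => n /=; have [[_ _]] := W n.
      rewrite /Rintegral => hn; rewrite -[LHS]fineK ?hn//.
      apply: (integrable_fin_num measurableT); apply: sqint_mul => //; exact: (W n).1.
have [_ h0] := W h sh.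
have : h = cst 0 %[ae mu].
  by apply: sqint_eq0 => //; rewrite -[RHS]h0; apply: eq_Rintegral.
by apply: filterS => x /(_ I) hx _; apply/eqP; rewrite -subr_eq0; apply/eqP; exact: hx.
Qed.

End test_functions.

(** * Translations and averages *)

Section translation.
Context {R : realType} {N : nat}.
Let mu := lebesgue_rV R N.
Implicit Types (u : 'rV[R]_N -> R) (y : 'rV[R]_N).

Lemma integral_shift y (f : 'rV[R]_N -> \bar R) : measurable_fun setT f ->
  (\int[mu]_x f (x + y)%R = \int[mu]_x f x)%E.
Proof.
move=> mf; rewrite integralE [RHS]integralE; congr (_ - _)%E.
  rewrite -[RHS](integral_translation y (measurable_funepos mf) (fun x => funepos_ge0 f
    x)).
  by apply: eq_integral => x _; rewrite !funeposE.
rewrite -[RHS](integral_translation y (measurable_funeneg mf) (fun x => funeneg_ge0 f x)).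
by apply: eq_integral => x _; rewrite !funenegE.
Qed.

Lemma Rintegral_shift y u : measurable_fun setT u ->
  \int[mu]_x u (x + y) = \int[mu]_x u x.
Proof.
by move=> mu_; rewrite /Rintegral (integral_shift y (f := EFin \o u))//;
  exact/measurable_EFinP.
Qed.

Lemma sqint_shift y u : sqint mu u -> sqint mu (fun x => u (x + y)).
Proof.
move=> [mu_ uoo]; split; first exact: (measurableT_comp mu_ (measurable_add_rV y)).
rewrite (integral_shift y (f := fun x => (u x ^+ 2)%:E))//.
by apply/measurable_EFinP; exact: measurable_funX.
Qed.

Lemma nrm2_shift y u : sqint mu u -> nrm2 mu (fun x => u (x + y)) = nrm2 mu u.
Proof.
move=> [mu_ uoo]; rewrite /nrm2 (Rintegral_shift y (u := fun x => u x ^+ 2))//.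
exact: measurable_funX.
Qed.

(** By density: bump functions are continuous with bounded support, and since translations preserve
    the L^2 norm the property passes to L^2 limits. *)
Lemma translation_continuous u : sqint mu u -> forall e, 0 < e ->
  exists2 r, 0 < r & forall y, cube r y -> nrm2 mu (fun x => u (x + y) - u x) <= e.
Proof.
pose W u := sqint mu u /\ forall e, 0 < e ->
  exists2 r, 0 < r & forall y, cube r y -> nrm2 mu (fun x => u (x + y) - u x) <= e.
suff : forall u, sqint mu u -> W u by move=> H /H[].
apply: density.
- move=> k f g [sf hf] [sg hg]; split.
    by apply: sqintD => //; exact: sqintZ.
  (* [nrm2D] doubles both terms: [2 * k ^+ 2 * e / (4 * (k ^+ 2 + 1)) <= e / 2] and
     [2 * (e / 4) = e / 2]. *)
  move=> e e0; have K0 : 0 < 4 * (k ^+ 2 + 1) by rewrite mulr_gt0// ltr_wpDl// sqr_ge0.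
  have [r1 r10 h1] := hf _ (divr_gt0 e0 K0).
  have [r2 r20 h2] := hg _ (divr_gt0 e0 (ltr0n _ 4)).
  exists (Num.min r1 r2); first by rewrite lt_min r10.
  move=> y cy.
  have c1 : cube r1 y.
    by move=> i; have := cy i; rewrite !in_itv/= -!ltr_norml lt_min => /andP[].
  have c2 : cube r2 y.
    by move=> i; have := cy i; rewrite !in_itv/= -!ltr_norml lt_min => /andP[].
  have sdf : sqint mu (fun x => f (x + y) - f x) by apply: sqintB => //;
    exact: sqint_shift.
  have sdg : sqint mu (fun x => g (x + y) - g x) by apply: sqintB => //;
    exact: sqint_shift.
  have := nrm2D (sqintZ k sdf) sdg; rewrite nrm2Z//.
  rewrite [X in X <= _ -> _](_ : _ = nrm2 mu (fun x => k * f (x + y) + g (x + y) -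
    (k * f x + g x))); last first.
    by apply: eq_Rintegral => x _; ring.
  move=> /le_trans; apply.
  have h2' := h2 y c2.
  have : k ^+ 2 * nrm2 mu (fun x => f (x + y) - f x) <= e / 4.
    apply: (@le_trans _ _ (k ^+ 2 * (e / (4 * (k ^+ 2 + 1))))).
      by rewrite ler_wpM2l ?sqr_ge0// h1.
    rewrite mulrA ler_pdivrMr// (_ : e / 4 * _ = e * (k ^+ 2 + 1)); last by field.
    by have := sqr_ge0 k; nra.
  lra.
- move=> c a b f c0 Bf; have tf := bump_test c0 Bf; have sf := test_sqint tf.
  (* Dominated convergence concerns sequences, so the absence of a radius is turned into a sequence
     [y n] tending to 0 along which the distance stays above [e]. As [y n] lies in the unit cube,
     one enlargement of the support, [cube (r + 1)], works for all [n]. *)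
  split => // e e0; apply: contrapT => H.
  have /choice[y yP] (n : nat) : exists y, cube n.+1%:R^-1 y /\ e < nrm2 mu (fun x =>
    f (x + y) - f x).
    apply: contrapT => /forallNP h; apply: H; exists n.+1%:R^-1 => // y cy.
    by rewrite leNgt; apply/negP => ?; apply: (h y).
  have [M [r [M0 Mr]]] := test_dominated tf.
  have cf := test_continuous tf.
  have y0 : y @ \oo --> (0 : 'rV[R]_N).
    apply/cvg_ballP => /= e1 e10; near=> n => /=; split => // i j.
    rewrite mxE (ord1 i) /ball/= sub0r normrN ltr_norml.
    have := (yP n).1 j; rewrite in_itv/= => /andP[h1 h2].
    have ne : n.+1%:R^-1 < e1 by near: n; exact: (near_infty_natSinv_lt (PosNum e10)).
    apply/andP; split; last exact: lt_trans h2 ne.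
    by apply: lt_trans h1; rewrite ltrN2.
  have dom n x : `|f (x + y n)| <= M * \1_(cube (r + 1)) x.
    apply: le_trans (Mr _) _; rewrite ler_wpM2l// !indicE ler_nat.
    case: (boolP (_ \in cube r)) => //= /[!inE] xr.
    rewrite (_ : _ \in _ = true)//; apply/mem_set => i.
    have := xr i; have := (yP n).1 i; rewrite !in_itv/= mxE.
    have : n.+1%:R^-1 <= 1 :> R by rewrite invf_le1// ler1n.
    move: (n.+1%:R^-1 : R) => z z1 /andP[? ?] /andP[? ?].
    by apply/andP; split; lra.
  have fc x : (fun n => f (x + y n)) @ \oo --> f x.
    have h : (fun n => x + y n) @ \oo --> x by rewrite -{2}(addr0 x); apply: cvgD => //;
      exact: cvg_cst.
    exact: (cvg_comp _ _ h (cf x)).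
  have [_] := @dominated_sq _ _ _ mu (fun n x => f (x + y n)) f _
     (fun n => (sqint_shift (y n) sf).1) (sqintZ M (sqint_cube N (r + 1))) dom
     fc.
  move=> /cvgr_lt /(_ e e0) [n _ /(_ n (leqnn n))]/=.
  by rewrite ltNge (ltW (yP n).2).
- move=> f_ f g W_ sg fg ff.
  have mf_ n : measurable_fun setT (f_ n) by have [[]] := W_ n.
  have [sf lim0] := dominated_sq mf_ sg fg ff; split => // e e0.
  (* Applying [nrm2D] twice gives the three terms the weights 2, 4 and 4, and
     [10 * (e / 12) <= e]. *)
  have e12 : 0 < e / 12 by rewrite divr_gt0.
  move/cvgr_lt: lim0 => /(_ _ e12)[n _ /(_ n (leqnn n))/= hn].
  have [sn /(_ (e / 12) e12)[r r0 rP]] := W_ n.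
  exists r => // y /rP h.
  have s1 : sqint mu (fun x => f_ n x - f x) by exact: sqintB.
  have s2 : sqint mu (fun x => f_ n (x + y) - f_ n x) by apply: sqintB => //;
    exact: sqint_shift.
  have s3 : sqint mu (fun x => f (x + y) - f_ n (x + y)).
    by apply: sqintB; exact: sqint_shift.
  have s4 : sqint mu (fun x => (f_ n (x + y) - f_ n x) + (f_ n x - f x)) by exact: sqintD.
  have n3 : nrm2 mu (fun x => f (x + y) - f_ n (x + y)) < e / 12.
    rewrite (nrm2_shift y (u := fun x => f x - f_ n x)); last exact: sqintB.
    by apply: le_lt_trans hn; rewrite le_eqVlt; apply/orP; left; apply/eqP;
      apply: eq_Rintegral => x _; ring.
  have := nrm2D s3 s4; have := nrm2D s2 s1.
  rewrite [X in _ -> X <= _ -> _](_ : _ = nrm2 mu (fun x => f (x + y) - f x)); last first.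
    by apply: eq_Rintegral => x _; ring.
  rewrite -/(nrm2 mu (fun x => f_ n x - f x)) in hn.
  move: h n3 hn; rewrite /nrm2.
  move: (\int[mu]_x _) (\int[mu]_x _) (\int[mu]_x _) (\int[mu]_x _) (\int[mu]_x _) =>
    A B C D E.
  lra.
Unshelve. all: by end_near. Qed.

End translation.

(** * Averages over cubes: L^2 contraction and weak derivatives *)

Section averaging.
Context {R : realType} {N : nat}.
Let mu := lebesgue_rV R N.
Variable r : R.
Hypothesis r0 : 0 < r.
Implicit Types (u g : 'rV[R]_N -> R) (x y : 'rV[R]_N).

Definition vol : R := (r + r) ^+ N.

Lemma vol_gt0 : 0 < vol.
Proof. by rewrite exprn_gt0// addr_gt0. Qed.

Lemma vol_cube : (\int[mu]_y (\1_(cube r) y)%:E = vol%:E)%E.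
Proof.
rewrite integral_indic//; last exact: measurable_cubeE.
rewrite setIT.
transitivity ((@lebesgue_measure R `](- r)%R, r[%classic) ^+ N)%E.
  exact: (lebesgue_rV_cube N (measurable_itv `]- r, r[)).
rewrite lebesgue_measure_itv /= lte_fin gtrN// opprK.
by rewrite EFin_expe EFinD.
Qed.

Lemma indic_sq (T : Type) (A : set T) (x : T) : (\1_A x : R) ^+ 2 = \1_A x.
Proof. by rewrite indicE; case: (_ \in _); rewrite ?expr0n ?expr1n. Qed.

Lemma integrable_cube : mu.-integrable setT (fun y => (\1_(cube r) y : R)%:E).
Proof.
have := sqint_integrable (sqint_cube N r).
by under eq_fun do rewrite indic_sq.
Qed.

Lemma Rvol_cube : \int[mu]_y (\1_(cube r) y : R) = vol.
Proof. by rewrite /Rintegral vol_cube. Qed.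

(** The mean of [w] over [cube r]. The cube enters through its indicator, so that all double
    integrals range over the whole product space. *)
Definition wavg (w : 'rV[R]_N -> R) : R := vol^-1 * \int[mu]_y (w y * \1_(cube r) y).

(** The variance [\int (w - m) ^+ 2] over the cube is nonnegative, where [m] is the mean; expanding
    the square gives the bound. *)
Lemma wavg_jensen w : sqint mu (fun y => w y * \1_(cube r) y) ->
  wavg w ^+ 2 <= vol^-1 * \int[mu]_y (w y ^+ 2 * \1_(cube r) y).
Proof.
move=> sw; have v0 := vol_gt0; have sc := sqint_cube N r.
set m := wavg w.
have idc x : (\1_(cube r) x : R) ^+ 2 = \1_(cube r) x by exact: indic_sq.
have := nrm2_ge0 mu (fun y => w y * \1_(cube r) y - m * \1_(cube r) y).
rewrite /nrm2.
rewrite (@eq_Rintegral _ _ _ mu setT (fun y => (w y ^+ 2 * \1_(cube r) y + (-(2 * m)) *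
  (w y * \1_(cube r) y)) + m ^+ 2 * \1_(cube r) y)); last first.
  by move=> x _; rewrite !indicE; case: (x \in _) => /=; ring.
have i1 : mu.-integrable setT (fun y => (w y ^+ 2 * \1_(cube r) y)%:E).
  by have := sqint_integrable sw; under eq_fun do rewrite exprMn idc.
have i2 : mu.-integrable setT (fun y => (w y * \1_(cube r) y)%:E).
  by have := sqint_mul sw sc; under eq_fun do rewrite -mulrA -expr2 idc.
have i3 : mu.-integrable setT (fun y => (-(2 * m) * (w y * \1_(cube r) y))%:E).
  exact: (integrableZl measurableT _ i2).
have i4 : mu.-integrable setT (fun y => (m ^+ 2 * \1_(cube r) y)%:E).
  exact: (integrableZl measurableT _ integrable_cube).
rewrite RintegralD//; last exact: (integrableD measurableT i1 i3).
rewrite RintegralD// (RintegralZl _ measurableT i2) (RintegralZl _ measurableT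
  integrable_cube).
rewrite Rvol_cube.
have -> : \int[mu]_y (w y * \1_(cube r) y) = vol * m by rewrite /m /wavg mulrA divff
  ?mul1r ?gt_eqF.
move=> h; rewrite mulrC ler_pdivlMr//; move: h.
by move: (\int[mu]_y _) => A; rewrite -subr_ge0; nra.
Qed.

Lemma measurable_Rintegral2 (F : 'rV[R]_N * 'rV[R]_N -> R) : measurable_fun setT F ->
  measurable_fun setT (fun x => \int[mu]_y F (x, y)).
Proof.
move=> mF; apply: measurableT_comp => //.
under eq_fun do rewrite integralE.
apply: emeasurable_funB.
  have mp : measurable_fun setT ((EFin \o F)^\+)%E.
    by apply: measurable_funepos; exact/measurable_EFinP.
  have := @measurable_fun_fubini_tonelli_F _ _ _ _ _ mu _ mp (funepos_ge0 _).
  apply: eq_measurable_fun => x _.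
  by apply: eq_integral => y _; rewrite !funeposE.
have mn : measurable_fun setT ((EFin \o F)^\-)%E.
  by apply: measurable_funeneg; exact/measurable_EFinP.
have := @measurable_fun_fubini_tonelli_F _ _ _ _ _ mu _ mn (funeneg_ge0 _).
apply: eq_measurable_fun => x _.
by apply: eq_integral => y _; rewrite !funenegE.
Qed.

Lemma measurable_add2 : measurable_fun setT (fun z : 'rV[R]_N * 'rV[R]_N => z.1 + z.2).
Proof.
apply: measurable_fun_rV => i; under eq_fun do rewrite mxE.
by apply: measurable_funD; apply: (measurableT_comp (@measurable_coor R N i)).
Qed.

Lemma measurable_icube : measurable_fun setT (\1_(cube r) : 'rV[R]_N -> R).
Proof. by apply: measurable_indic; exact: measurable_cubeE. Qed.

Lemma measurable_cube2 : measurable_fun setT (fun z : 'rV[R]_N * 'rV[R]_N => \1_(cube r)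
  z.2 : R).
Proof. exact: (measurableT_comp measurable_icube (@measurable_snd _ _ _ _)). Qed.

(** Jensen's inequality in [y], then Tonelli to integrate in [x] first. It serves twice: with
    [u (x + y)] for the contraction property, and with [u (x + y) - u x] for the distance from [u]
    to its average. *)
Lemma wavg_sqint (w : 'rV[R]_N * 'rV[R]_N -> R) K : measurable_fun setT w ->
  (forall x, sqint mu (fun y => w (x, y) * \1_(cube r) y)) ->
  (forall y, cube r y -> (\int[mu]_x (w (x, y) ^+ 2)%:E <= K%:E)%E) ->
  sqint mu (fun x => wavg (fun y => w (x, y))) /\
  nrm2 mu (fun x => wavg (fun y => w (x, y))) <= K.
Proof.
move=> mw sw wK; have v0 := vol_gt0.
have mww : measurable_fun setT (fun z => w z * \1_(cube r) z.2).
  by apply: measurable_funM => //; exact: measurable_cube2.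
have mw2 : measurable_fun setT (fun z => (w z ^+ 2 * \1_(cube r) z.2)%:E).
  apply/measurable_EFinP; apply: measurable_funM; last exact: measurable_cube2.
  exact: measurable_funX.
have mavg : measurable_fun setT (fun x => wavg (fun y => w (x, y))).
  by apply: measurable_funM => //; exact: (measurable_Rintegral2 mww).
have K0 : 0 <= K.
  have c0 : cube r (0 : 'rV[R]_N) by move=> i; rewrite mxE in_itv/= oppr_lt0 r0.
  have := wK 0 c0.
  rewrite -lee_fin; apply: le_trans; apply: integral_ge0 => x _.
  by rewrite lee_fin sqr_ge0.
have idc x : (\1_(cube r) x : R) ^+ 2 = \1_(cube r) x by exact: indic_sq.
have H : (\int[mu]_x (wavg (fun y => w (x, y)) ^+ 2)%:E <= K%:E)%E.
  have mF : measurable_fun setT (fun x => \int[mu]_y (w (x, y) ^+ 2 * \1_(cube r)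
    y)%:E)%E.
    apply: (@measurable_fun_fubini_tonelli_F _ _ _ _ _ mu (fun z =>
      (w z ^+ 2 * \1_(cube r) z.2)%:E)) => // z.
    by rewrite lee_fin mulr_ge0 ?sqr_ge0.
  apply: (@le_trans _ _ (\int[mu]_x (vol^-1%:E * \int[mu]_y (w (x, y) ^+ 2 * \1_(cube r)
    y)%:E)))%E.
    apply: ge0_le_integral => //.
    - by move=> x _; rewrite lee_fin sqr_ge0.
    - by apply/measurable_EFinP; exact: measurable_funX.
    - exact: measurable_funeM.
    - move=> x _; apply: (@le_trans _ _ (vol^-1 * \int[mu]_y (w (x, y) ^+ 2 * \1_(cube r)
      y))%:E).
        by rewrite lee_fin; exact: wavg_jensen.
      rewrite EFinM /Rintegral fineK//.
      have /(integrable_fin_num measurableT) := sqint_integrable (sw x).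
      by under eq_integral do rewrite exprMn idc.
  rewrite ge0_integralZl//; last 2 first.
    - by move=> x _; apply: integral_ge0 => y _; rewrite lee_fin mulr_ge0 ?sqr_ge0.
    - by rewrite lee_fin invr_ge0 ltW.
  rewrite (@fubini_tonelli _ _ _ _ _ mu mu (fun z => (w z ^+ 2 * \1_(cube r) z.2)%:E))//;
    last first.
    by move=> z; rewrite lee_fin mulr_ge0 ?sqr_ge0.
  apply: (@le_trans _ _ (vol^-1%:E * \int[mu]_y (K%:E * (\1_(cube r) y)%:E)))%E.
    apply: lee_wpmul2l; first by rewrite lee_fin invr_ge0 ltW.
    apply: ge0_le_integral => //.
    - by move=> y _; apply: integral_ge0 => x _; rewrite lee_fin mulr_ge0 ?sqr_ge0.
    - apply: (@measurable_fun_fubini_tonelli_G _ _ _ _ _ mu (fun z =>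
      (w z ^+ 2 * \1_(cube r) z.2)%:E)) => // z.
      by rewrite lee_fin mulr_ge0 ?sqr_ge0.
    - by apply: measurable_funeM; apply/measurable_EFinP; exact: measurable_icube.
    - move=> y _ /=; rewrite indicE; case: (boolP (y \in cube r)) => yc /=.
        under eq_integral do rewrite mulr1.
        by rewrite mule1; apply: wK; rewrite inE in yc.
      by rewrite mule0; under eq_integral do rewrite mulr0; rewrite integral0.
  rewrite ge0_integralZl//; last first.
    by apply/measurable_EFinP; exact: measurable_icube.
  by rewrite vol_cube -!EFinM lee_fin mulrCA mulVf ?gt_eqF// mulr1.
have savg : sqint mu (fun x => wavg (fun y => w (x, y))).
  by split => //; exact: le_lt_trans H (ltry _).
by split => //; rewrite -lee_fin -nrm2E.
Qed.

Definition avg u x := wavg (fun y => u (x + y)).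

Lemma sqint_mul_cube u : sqint mu u -> sqint mu (fun y => u y * \1_(cube r) y).
Proof.
move=> su; apply: (sqint_le _ su) => [|x].
  by apply: measurable_funM; [exact: su.1|exact: measurable_icube].
by rewrite indicE normrM; case: (_ \in _); rewrite /= ?normr1 ?mulr1// normr0 mulr0.
Qed.

Lemma sqint_shiftl u x : sqint mu u -> sqint mu (fun y => u (x + y)).
Proof. by move=> su; under eq_fun do rewrite addrC; exact: sqint_shift. Qed.

Lemma avg_sqint u : sqint mu u -> sqint mu (avg u) /\ nrm2 mu (avg u) <= nrm2 mu u.
Proof.
move=> su; apply: (wavg_sqint (w := fun z => u (z.1 + z.2))).
- by apply: measurableT_comp su.1 measurable_add2.
- by move=> x; apply: sqint_mul_cube; exact: sqint_shiftl.
- by move=> y _; rewrite (nrm2E (sqint_shift y su)) lee_fin nrm2_shift.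
Qed.

Lemma wavg_cst k : wavg (fun=> k) = k.
Proof.
rewrite /wavg RintegralZl//; last exact: integrable_cube.
by rewrite Rvol_cube mulrCA mulVf ?mulr1// gt_eqF// vol_gt0.
Qed.

Lemma integrable_mul_cube u : sqint mu u ->
  mu.-integrable setT (fun y => (u y * \1_(cube r) y)%:E).
Proof. by move=> su; apply: sqint_mul => //; exact: sqint_cube. Qed.

Lemma avg_close u K : sqint mu u ->
  (forall y, cube r y -> nrm2 mu (fun x => u (x + y) - u x) <= K) ->
  nrm2 mu (fun x => avg u x - u x) <= K.
Proof.
move=> su uK.
have E x : avg u x - u x = wavg (fun y => u (x + y) - u x).
  rewrite -[in LHS](wavg_cst (u x)) /avg /wavg -mulrBr -RintegralB//.
  - by congr (_ * _); apply: eq_Rintegral => y _; rewrite mulrBl.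
  - exact: integrable_mul_cube (sqint_shiftl x su).
  - exact: (integrableZl measurableT (u x) integrable_cube).
rewrite (_ : (fun x => _) = fun x => wavg (fun y => u (x + y) - u x)); last exact/funext.
apply: (wavg_sqint (w := fun z => u (z.1 + z.2) - u z.1) _ _ _).2.
- apply: measurable_funB; first by apply: measurableT_comp su.1 measurable_add2.
  exact: (measurableT_comp su.1).
- move=> x /=; under eq_fun do rewrite mulrBl; apply: sqintB.
    by apply: sqint_mul_cube; exact: sqint_shiftl.
  by apply: sqintZ; exact: sqint_cube.
- move=> y cy; rewrite (nrm2E (f := fun x => u (x + y) - u x)) ?lee_fin ?uK//.
  by apply: sqintB => //; exact: sqint_shift.
Qed.

Lemma avg_bounded u x : sqint mu u -> avg u x ^+ 2 <= vol^-1 * nrm2 mu u.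
Proof.
move=> su; have sx := sqint_shiftl x su.
apply: le_trans (wavg_jensen (sqint_mul_cube sx)) _.
rewrite ler_wpM2l ?invr_ge0 ?(ltW vol_gt0)//.
rewrite -(nrm2_shift x su) /nrm2.
apply: le_Rintegral => //.
- have := sqint_integrable (sqint_mul_cube sx).
  by under eq_fun => y do rewrite exprMn indic_sq.
- exact: (sqint_integrable (sqint_shift x su)).
- by move=> y _; rewrite addrC indicE; case: (_ \in _); rewrite /= ?mulr1 ?mulr0 ?sqr_ge0.
Qed.

(** Fubini's theorem. Pairing an average with [h] becomes an average of pairings of translates,
    where each translation can be moved to the other factor. *)
Lemma avg_dual u h : sqint mu u -> sqint mu h ->
  \int[mu]_x (avg u x * h x) =
  vol^-1 * \int[mu]_y (\1_(cube r) y * \int[mu]_x (u (x + y) * h x)).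
Proof.
move=> su sh.
pose F (z : 'rV[R]_N * 'rV[R]_N) : R := u (z.1 + z.2) * \1_(cube r) z.2 * h z.1.
have mF : measurable_fun setT F.
  apply: measurable_funM; last exact: (measurableT_comp sh.1).
  apply: measurable_funM; last exact: measurable_cube2.
  by apply: measurableT_comp su.1 measurable_add2.
have iF : (mu \x mu)%E.-integrable setT (EFin \o F).
  apply/integrable21ltyP; first exact/measurable_EFinP.
  (* For each [y] in the cube, [|u (x + y) * h x| <= u (x + y) ^+ 2 + h x ^+ 2] bounds the inner
     integral uniformly. *)
  apply: (@le_lt_trans _ _ (\int[mu]_y ((nrm2 mu u + nrm2 mu h)%:E *
    (\1_(cube r) y)%:E)))%E; last first.
    rewrite ge0_integralZl//.
    - by rewrite vol_cube ltry.
    - by apply/measurable_EFinP; exact: measurable_icube.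
    - by rewrite lee_fin addr_ge0 ?nrm2_ge0.
  apply: ge0_le_integral => //.
  - by move=> y _; apply: integral_ge0.
  - apply: (@measurable_fun_fubini_tonelli_G _ _ _ _ _ mu (abse \o (EFin \o F))) => [|z];
    last exact: abse_ge0.
    by apply: measurableT_comp => //; exact/measurable_EFinP.
  - by apply: measurable_funeM; apply/measurable_EFinP; exact: measurable_icube.
  - move=> y _ /=; rewrite /F /= indicE; case: (boolP (y \in cube r)) => yc /=;
    last first.
      by under eq_integral do rewrite mulr0 mul0r normr0; rewrite integral0 mule0.
    rewrite mule1 -(nrm2_shift y su) EFinD -!nrm2E//; last exact: sqint_shift.
    rewrite -ge0_integralD//; last 4 first.
    + by move=> x _; rewrite lee_fin sqr_ge0.
    + by apply/measurable_EFinP; apply: measurable_funX; exact: (sqint_shift y su).1.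
    + by move=> x _; rewrite lee_fin sqr_ge0.
    + by apply/measurable_EFinP; apply: measurable_funX; exact: sh.1.
    apply: ge0_le_integral => //.
    + apply/measurable_EFinP; apply: measurableT_comp => //.
      apply: measurable_funM; last exact: sh.1.
      by apply: measurable_funM => //; exact: (sqint_shift y su).1.
    + by apply: emeasurable_funD; apply/measurable_EFinP; apply: measurable_funX;
      [exact: (sqint_shift y su).1|exact: sh.1].
    + move=> x _; rewrite -EFinD lee_fin mulr1 normrM.
      rewrite -[u _ ^+ 2]real_normK ?num_real// -[h _ ^+ 2]real_normK ?num_real//.
      by rewrite -subr_ge0; have := sqr_ge0 (`|u (x + y)| - `|h x|); nra.
have := Fubini iF.
have -> : (\int[mu]_x \int[mu]_y (EFin \o F) (x, y) = \int[mu]_x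
  (vol * (avg u x * h x))%:E)%E.
  apply: eq_integral => x _.
  rewrite -[LHS]fineK; last first.
    apply: (integrable_fin_num measurableT).
    have := integrableZl measurableT (h x) (integrable_mul_cube (sqint_shiftl x su)).
    by under eq_fun do rewrite -EFinM mulrC.
  congr EFin; rewrite /avg /wavg !mulrA divff ?mul1r ?gt_eqF ?vol_gt0//.
  rewrite -RintegralZr//; exact: integrable_mul_cube (sqint_shiftl x su).
have -> : (\int[mu]_y \int[mu]_x (EFin \o F) (x, y) = \int[mu]_y (\1_(cube r) y *
  \int[mu]_x (u (x + y) * h x))%:E)%E.
  apply: eq_integral => y _.
  rewrite -[LHS]fineK; last first.
    apply: (integrable_fin_num measurableT).
    have := integrableZl measurableT (\1_(cube r) y) (sqint_mul (sqint_shift y su) sh).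
    by under eq_fun do rewrite -EFinM mulrCA mulrA.
  congr EFin; rewrite -RintegralZl//; last exact: sqint_mul (sqint_shift y su) sh.
  by apply: eq_Rintegral => x _; rewrite /F/=; ring.
move=> E; rewrite {2}/Rintegral -E -/(Rintegral _ _ _) RintegralZl//; last first.
  by apply: sqint_mul => //; exact: (avg_sqint su).1.
by rewrite mulrA mulVf ?mul1r// gt_eqF// vol_gt0.
Qed.

(** After [avg_dual] it is enough to treat one translate of [u]; the change of variables moves the
    translation to the test function, and a translated test function is again one. *)
Lemma avg_weak_partial i u g : sqint mu u -> sqint mu g ->
  weak_partial i u g -> weak_partial i (avg u) (avg g).
Proof.
move=> su sg w phi tphi.
have sphi := test_sqint tphi; have sp := test_sqint (test_partial i tphi).
have snphi : sqint mu (fun x => -1 * phi x) by exact: sqintZ.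
have sag := (avg_sqint sg).1.
(* The minus sign is absorbed into [phi], so that both sides have the form to which [avg_dual]
   applies. *)
rewrite -mulN1r -RintegralZl//; last exact: sqint_mul.
transitivity (\int[mu]_x (avg g x * (-1 * phi x))); last first.
  by apply: eq_Rintegral => x _; rewrite mulrCA.
rewrite avg_dual// avg_dual//; congr (_ * _).
apply: eq_Rintegral => y _; congr (_ * _).
transitivity (\int[mu]_x (-1 * (g (x + y) * phi x))); last first.
  by apply: eq_Rintegral => x _; rewrite mulrCA.
rewrite RintegralZl//; last exact: (sqint_mul (sqint_shift y sg) sphi).
rewrite mulN1r.
transitivity (\int[mu]_x (u x * partial i phi (x - y))).
  rewrite -(Rintegral_shift y (u := fun x => u x * partial i phi (x - y))).
    by apply: eq_Rintegral => x _; rewrite addrK.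
  apply: measurable_funM; first exact: su.1.
  exact: (sqint_shift (- y) sp).1.
have := w _ (test_shift (- y) tphi); rewrite partial_shift => ->.
congr (- _).
rewrite -(Rintegral_shift y (u := fun x => g x * phi (x - y))).
  by apply: eq_Rintegral => x _; rewrite addrK.
apply: measurable_funM; first exact: sg.1.
exact: (sqint_shift (- y) sphi).1.
Qed.

End averaging.

(** * Almost everywhere convergence from summable L^2 errors *)

Section fast_convergence.
Context d (T : measurableType d) (R : realType) (mu : {measure set T -> \bar R}).

(** The series of the squares has a finite integral, so it converges almost everywhere and its terms
    tend to 0. The geometric rate makes the extraction of a subsequence unnecessary. *)
Lemma fast_sq_cvg_ae (v : nat -> T -> R) : (forall n, sqint mu (v n)) ->
  (forall n, nrm2 mu (v n) <= 2^-1 ^+ n) ->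
  {ae mu, forall x, v ^~ x @ \oo --> (0 : R)}.
Proof.
move=> sv nv.
have mv n : measurable_fun setT (fun x => (v n x ^+ 2)%:E).
  by apply/measurable_EFinP; apply: measurable_funX; exact: (sv n).1.
have v0 n x : (0 <= (v n x ^+ 2)%:E)%E by rewrite lee_fin sqr_ge0.
pose S x := (\sum_(n <oo) (v n x ^+ 2)%:E)%E.
have mS : measurable_fun setT S by exact: ge0_emeasurable_sum.
have S0 x : (0 <= S x)%E by exact: nneseries_ge0.
have : mu.-integrable setT S.
  apply/integrableP; split => //.
  under eq_integral do rewrite gee0_abs//.
  rewrite integral_nneseries//.
  apply: (@le_lt_trans _ _ (\sum_(n <oo) (2^-1 ^+ n : R)%:E)%E).
    apply: lee_nneseries => [n _ _|n _]; first exact: integral_ge0.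
    by rewrite nrm2E// lee_fin.
  have h : series (geometric 1 (2^-1 : R)) @ \oo --> (1 * (1 - 2^-1)^-1 : R).
    by apply: cvg_geometric_series; rewrite ger0_norm// invf_lt1// ltr1n.
  rewrite (_ : (\sum_(n <oo) _)%E = (1 * (1 - 2^-1)^-1 : R)%:E) ?ltry//.
  apply/cvg_lim => //; apply: cvg_EFin; first by apply: nearW => n; apply/sum_fin_numP.
  move: h; apply: cvg_trans; apply: near_eq_cvg; apply: nearW => n /=.
  rewrite sumEFin/=; apply: eq_bigr => i _; by rewrite /geometric/= mul1r.
move=> /(integrable_ae measurableT); apply: filterS => x /(_ I) Sfin.
have : v ^~ x \* v ^~ x @ \oo --> (0 : R).
  apply: cvg_series_cvg_0; apply: nnseries_is_cvg => [n|].
    by rewrite /= -expr2 sqr_ge0.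
  by move: Sfin; rewrite ge0_fin_numE//.
move=> h; apply/cvgr0Pnorm_lt => e e0.
move/cvgr0Pnorm_lt : h => /(_ _ (exprn_gt0 2 e0)); apply: filterS => n /=.
by rewrite -expr2 normrX ltr_pXn2r// nnegrE ltW.
Qed.

End fast_convergence.

Lemma powR_cvg {R : realType} (s : nat -> R) (l r : R) : 0 < r -> (forall n, 0 <= s n) ->
  s @ \oo --> l -> (fun n => s n `^ r) @ \oo --> l `^ r.
Proof.
move=> r0 s0 sl.
have l0 : 0 <= l by apply: (cvgr_to_ge sl); exact: nearW.
(* The derivative of [powR] yields continuity at positive points only; at 0 the inverse power gives
   the threshold. *)
move: l0; rewrite le_eqVlt => /predU1P[l0|l0].
  rewrite -l0 in sl *; rewrite powR0 ?gt_eqF//; apply/cvgr0Pnorm_lt => e e0.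
  move/cvgr0Pnorm_lt : sl => /(_ _ (powR_gt0 r^-1 e0)); apply: filterS => n.
  rewrite !ger0_norm ?powR_ge0// => sn.
  have := gt0_ltr_powR r0 _ _ sn; rewrite !nnegrE powR_ge0 s0 => /(_ isT isT).
  by rewrite -powRrM mulVf ?gt_eqF// powRr1// ltW.
have [/derivable1_diffP/differentiable_continuous c _] := is_derive1_powR r l0.
exact: (cvg_comp _ _ sl c).
Qed.

(** * The energy and its Nehari set *)

Section functional.
Context {R : realType} (N : nat).
Let mu := lebesgue_rV R N.
Variables (p ainf binf : R) (a b : 'rV[R]_N -> R).
Hypothesis N_ge2 : (2 <= N)%N.
Hypothesis p_gt1 : 1 < p.
Hypothesis ainf_gt0 : 0 < ainf.
Hypothesis binf_gt0 : 0 < binf.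
Hypothesis a_Lp : a \in Lfun mu (N%:R / 2)%:E.
Hypothesis a_ge0 : {ae mu, forall x, 0 <= a x}.
Hypothesis b_Loo : b \in Lfun mu +oo%E.
Hypothesis b_ge0 : {ae mu, forall x, 0 <= b x}.
Implicit Types (u v : 'rV[R]_N -> R).

Let q := p + 1.
Let q_gt2 : 2 < q. Proof. by rewrite /q -ltrBlDr (_ : 2 - 1 = 1 :> R)//; ring. Qed.
Let q_gt0 : 0 < q. Proof. exact: lt_trans q_gt2. Qed.

Let ma : measurable_fun setT a.
Proof. by move: a_Lp; rewrite inE => /andP[]; rewrite inE. Qed.

Let mb : measurable_fun setT b.
Proof. by move: b_Loo; rewrite inE => /andP[]; rewrite inE. Qed.

Lemma H1_sqint u : H1 u -> sqint mu u.
Proof. by move=> [/sqintP]. Qed.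

Lemma wgradP u i : H1 u -> sqint mu (wgrad u i) /\ weak_partial i u (wgrad u i).
Proof.
move=> [_ /(_ i)[g gL gw]].
have := @getPex _ [set g | g \in Lfun mu 2%:E /\ weak_partial i u g] (ex_intro _ g
  (conj gL gw)).
by move=> [/sqintP].
Qed.

Lemma wgrad_unique u i g : H1 u -> sqint mu g -> weak_partial i u g ->
  wgrad u i = g %[ae mu].
Proof. by move=> /(wgradP i)[s w] sg wg; exact: (weak_partial_unique s sg w wg). Qed.

Lemma H1I u (g : 'I_N -> 'rV[R]_N -> R) : sqint mu u -> (forall i, sqint mu (g i)) ->
  (forall i, weak_partial i u (g i)) -> H1 u.
Proof. by move=> su sg wg; split; [exact/sqintP|move=> i; exists (g i) => //;
  exact/sqintP]. Qed.

(* Extended-real integrals, so that divergence is visible; the absolute values make the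
   integrands nonnegative everywhere instead of almost everywhere. *)
Definition Gf u : \bar R :=
  (\int[mu]_x ((\sum_(i < N) wgrad u i x ^+ 2) + ainf * u x ^+ 2)%:E)%E.
Definition Af u : \bar R := (\int[mu]_x (`|a x| * u x ^+ 2)%:E)%E.
Definition Bf u : \bar R := (\int[mu]_x ((binf + `|b x|) * `|u x| `^ q)%:E)%E.
Definition Qf l u : \bar R := (Gf u + l%:E * Af u)%E.

(** Any square-integrable weak derivatives may stand for the chosen [wgrad], because they agree with
    it almost everywhere. For averages of [u] these are the averages of the derivatives of [u]. *)
Lemma GfE u (g : 'I_N -> 'rV[R]_N -> R) : sqint mu u -> (forall i, sqint mu (g i)) ->
  (forall i, weak_partial i u (g i)) ->
  Gf u = (\sum_(i < N) nrm2 mu (g i) + ainf * nrm2 mu u)%:E.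
Proof.
move=> su sg wg; have Hu := H1I su sg wg.
transitivity (\int[mu]_x ((\sum_(i < N) g i x ^+ 2) + ainf * u x ^+ 2)%:E)%E.
  have ms (h : 'I_N -> 'rV[R]_N -> R) : (forall i, sqint mu (h i)) ->
      measurable_fun setT (fun x => ((\sum_(i < N) h i x ^+ 2) + ainf * u x ^+ 2)%:E).
    move=> sh; apply/measurable_EFinP; apply: measurable_funD.
      by apply: measurable_sum => i; apply: measurable_funX; exact: (sh i).1.
    by apply: measurable_funM => //; apply: measurable_funX; exact: su.1.
  apply: ae_eq_integral => //.
  - by apply: ms => i; exact: (wgradP i Hu).1.
  - exact: ms.
  - have : \forall x \ae mu, forall i, wgrad u i x = g i x.
      apply: filter_forall => i; have := wgrad_unique Hu (sg i) (wg i).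
      by apply: filterS => x /(_ I).
    by apply: filterS => x h _; congr ((_ + _)%:E); apply: eq_bigr => i _; rewrite h.
have m2 h : sqint mu h -> measurable_fun setT (fun x => (h x ^+ 2)%:E).
  by move=> sh; apply/measurable_EFinP; apply: measurable_funX; exact: sh.1.
under eq_integral do rewrite EFinD -sumEFin EFinM.
rewrite ge0_integralD//; last 4 first.
- by move=> x _; apply: sume_ge0 => i _; rewrite lee_fin sqr_ge0.
- by apply: emeasurable_sum => i; exact: m2.
- by move=> x _; rewrite -EFinM lee_fin mulr_ge0 ?sqr_ge0// ltW.
- by apply: measurable_funeM; exact: m2.
rewrite ge0_integral_sum//; last 2 first.
- by move=> i; exact: m2.
- by move=> i x _; rewrite lee_fin sqr_ge0.
rewrite ge0_integralZl//; last 3 first.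
- exact: m2.
- by move=> x _; rewrite lee_fin sqr_ge0.
- by rewrite lee_fin ltW.
rewrite EFinD EFinM (nrm2E su) -sumEFin; congr (_ + _)%E.
by apply: eq_bigr => i _; exact: nrm2E.
Qed.

Lemma GfH1 u : H1 u -> Gf u = (\sum_(i < N) nrm2 mu (wgrad u i) + ainf * nrm2 mu u)%:E.
Proof.
move=> Hu; apply: GfE; first exact: H1_sqint.
  by move=> i; exact: (wgradP i Hu).1.
by move=> i; exact: (wgradP i Hu).2.
Qed.

Lemma Gf_gt0 u : H1 u -> ~ (u = cst 0 %[ae mu]) -> (0 < Gf u)%E.
Proof.
move=> Hu u0; rewrite GfH1// lte_fin ltr_wpDl//.
  by apply: sumr_ge0 => i _; exact: nrm2_ge0.
rewrite mulr_gt0// lt_neqAle nrm2_ge0 andbT; apply/negP => /eqP/esym n0.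
by apply: u0; apply: sqint_eq0 => //; exact: H1_sqint.
Qed.

Lemma Af_ge0 u : (0 <= Af u)%E.
Proof. by apply: integral_ge0 => x _; rewrite lee_fin mulr_ge0 ?sqr_ge0. Qed.

Lemma Bf_ge0 u : (0 <= Bf u)%E.
Proof.
apply: integral_ge0 => x _; rewrite lee_fin mulr_ge0 ?powR_ge0//.
by rewrite addr_ge0// ltW.
Qed.

Lemma measurable_Bint u : measurable_fun setT u ->
  measurable_fun setT (fun x => ((binf + `|b x|) * `|u x| `^ q)%:E).
Proof.
move=> mu_; apply/measurable_EFinP; apply: measurable_funM.
  by apply: measurable_funD => //; apply: measurableT_comp.
by apply: (measurableT_comp (measurable_powR _)) => //; exact: measurableT_comp.
Qed.

Lemma measurable_Aint u : measurable_fun setT u ->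
  measurable_fun setT (fun x => (`|a x| * u x ^+ 2)%:E).
Proof.
move=> mu_; apply/measurable_EFinP; apply: measurable_funM; last exact: measurable_funX.
exact: measurableT_comp.
Qed.

Lemma Bf_gt0 u : measurable_fun setT u -> ~ (u = cst 0 %[ae mu]) -> (0 < Bf u)%E.
Proof.
move=> mu_ u0; rewrite lt_neqAle Bf_ge0 andbT; apply/negP => /eqP/esym B0.
apply: u0; have : (\int[mu]_x `|((binf + `|b x|) * `|u x| `^ q)%:E| = 0)%E.
  rewrite -[RHS]B0; apply: eq_integral => x _; rewrite gee0_abs// lee_fin mulr_ge0
    ?powR_ge0//.
  by rewrite addr_ge0// ltW.
move/(ae_eq_integral_abs mu measurableT (measurable_Bint mu_)).
apply: filterS => x /(_ I)[/eqP]; rewrite mulf_eq0 => /orP[|].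
  by rewrite gt_eqF// ltr_wpDr.
by move/eqP/powR_eq0_eq0/eqP; rewrite normr_eq0 => /eqP ux _.
Qed.

Lemma Bf_eq0 u : measurable_fun setT u -> u = cst 0 %[ae mu] -> Bf u = 0%E.
Proof.
move=> mu_ u0; transitivity (\int[mu]_x (cst 0%E x))%E; last by rewrite integral0.
apply: ae_eq_integral => //; first exact: measurable_Bint.
by move: u0; apply: filterS => x /(_ I)/= -> _; rewrite normr0 powR0 ?gt_eqF// mulr0.
Qed.

Lemma weak_partialZ c u i : H1 u -> weak_partial i (fun x => c * u x) (fun x => c * wgrad
  u i x).
Proof.
move=> Hu phi tphi; have [sg wg] := wgradP i Hu.
transitivity (\int[mu]_x (c * (u x * partial i phi x))).
  by apply: eq_Rintegral => x _; rewrite mulrA.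
rewrite RintegralZl//; last first.
  by apply: sqint_mul; [exact: H1_sqint|exact/test_sqint/test_partial].
rewrite wg// mulrN -RintegralZl//; last by apply: sqint_mul => //; exact: test_sqint.
by congr (- _); apply: eq_Rintegral => x _; rewrite mulrA.
Qed.

Lemma H1Z c u : H1 u -> H1 (fun x => c * u x).
Proof.
move=> Hu; apply: (@H1I _ (fun i x => c * wgrad u i x)).
- by apply: sqintZ; exact: H1_sqint.
- by move=> i; apply: sqintZ; exact: (wgradP i Hu).1.
- by move=> i; exact: weak_partialZ.
Qed.

Lemma GfZ c u : H1 u -> Gf (fun x => c * u x) = ((c ^+ 2)%:E * Gf u)%E.
Proof.
move=> Hu; have su := H1_sqint Hu.
rewrite (GfE (g := fun i x => c * wgrad u i x)); last 3 first.
- exact: sqintZ.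
- by move=> i; apply: sqintZ; exact: (wgradP i Hu).1.
- by move=> i; exact: weak_partialZ.
rewrite GfH1// -EFinM mulrDr mulr_sumr nrm2Z// mulrCA; congr (_ + _)%:E.
by apply: eq_bigr => i _; rewrite nrm2Z//; exact: (wgradP i Hu).1.
Qed.

Lemma AfZ c u : measurable_fun setT u -> Af (fun x => c * u x) = ((c ^+ 2)%:E * Af u)%E.
Proof.
move=> mu_; rewrite /Af -ge0_integralZl//.
- by apply: eq_integral => x _; rewrite -EFinM exprMn mulrCA.
- exact: measurable_Aint.
- by move=> x _; rewrite lee_fin mulr_ge0 ?sqr_ge0.
- by rewrite lee_fin sqr_ge0.
Qed.

Lemma BfZ c u : measurable_fun setT u -> 0 <= c ->
  Bf (fun x => c * u x) = ((c `^ q)%:E * Bf u)%E.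
Proof.
move=> mu_ c0; rewrite /Bf -ge0_integralZl//.
- apply: eq_integral => x _; rewrite -EFinM normrM (ger0_norm c0) powRM//.
  by rewrite mulrCA.
- exact: measurable_Bint.
- by move=> x _; rewrite lee_fin mulr_ge0 ?powR_ge0// addr_ge0// ltW.
- by rewrite lee_fin powR_ge0.
Qed.

Lemma QfZ l c u : 0 <= l -> H1 u -> Qf l (fun x => c * u x) = ((c ^+ 2)%:E * Qf l u)%E.
Proof.
move=> l0 Hu; rewrite /Qf GfZ// AfZ; last exact: (H1_sqint Hu).1.
have G0 : (0 <= Gf u)%E.
  rewrite GfH1// lee_fin addr_ge0 ?sumr_ge0 ?mulr_ge0 ?nrm2_ge0// => [i _|].
    exact: nrm2_ge0.
  exact: ltW.
have A0 : (0 <= l%:E * Af u)%E by rewrite mule_ge0 ?Af_ge0.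
by rewrite (ge0_muleDr _ G0 A0) muleCA.
Qed.

(** A [Rintegral] is [fine] of the extended-real integral, so the formula also covers divergent
    integrals, through the value 0 of [fine] at infinity. *)
Lemma energyE l u : 0 <= l -> H1 u ->
  energy p ainf binf a b l u = 2^-1 * fine (Qf l u) - q^-1 * fine (Bf u).
Proof.
move=> l0 Hu; have su := H1_sqint Hu.
have mG : measurable_fun setT (fun x => ((\sum_(i < N) wgrad u i x ^+ 2) + ainf * u x ^+
  2)).
  apply: measurable_funD.
    by apply: measurable_sum => i; apply: measurable_funX; exact: (wgradP i Hu).1.1.
  by apply: measurable_funM => //; apply: measurable_funX; exact: su.1.
rewrite /energy; congr (_ * _ - _ * _).
  congr fine; rewrite /Qf /Gf /Af -ge0_integralZl//; last 2 first.
  - exact: measurable_Aint su.1.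
  - by move=> x _; rewrite lee_fin mulr_ge0 ?sqr_ge0.
  rewrite -ge0_integralD//; last 4 first.
  - move=> x _; rewrite lee_fin addr_ge0 ?sumr_ge0// => [i _|]; first exact: sqr_ge0.
    by rewrite mulr_ge0 ?sqr_ge0// ltW.
  - exact/measurable_EFinP.
  - by move=> x _; rewrite -EFinM lee_fin mulr_ge0// mulr_ge0// sqr_ge0.
  - by apply: measurable_funeM; exact: measurable_Aint su.1.
  apply: ae_eq_integral => //.
  - apply/measurable_EFinP; apply: measurable_funD.
      by apply: measurable_sum => i; apply: measurable_funX; exact: (wgradP i Hu).1.1.
    apply: measurable_funM; last by apply: measurable_funX; exact: su.1.
    by apply: measurable_funD => //; exact: measurable_funM.
  - apply: emeasurable_funD; first exact/measurable_EFinP.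
    by apply: measurable_funeM; exact: measurable_Aint su.1.
  - move: a_ge0; apply: filterS => x ax _; rewrite -EFinM -EFinD ger0_norm//.
    by congr (_%:E); ring.
congr fine; apply: ae_eq_integral => //.
- apply/measurable_EFinP; apply: measurable_funM; first exact: measurable_funD.
  by apply: (measurableT_comp (measurable_powR _)) => //; apply: measurableT_comp => //;
    exact: su.1.
- exact: measurable_Bint su.1.
- by move: b_ge0; apply: filterS => x bx _; rewrite (ger0_norm bx).
Qed.

(** Infinite values are included: both sides are then 0. *)
Lemma fine_mulpos (c : R) (X : \bar R) : 0 < c -> fine (c%:E * X) = c * fine X.
Proof.
move=> c0; case: X => [x| |]//=.
  by rewrite mulry gtr0_sg// mul1e/= mulr0.
by rewrite mulrNy gtr0_sg// mul1e/= mulr0.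
Qed.

(** While [1 + t > 0], the energy of [(1 + t) * u] is the explicit function [f] of [t], even if some
    integral diverges. The derivative therefore always exists, and uniqueness of derivatives gives
    the equivalence. *)
Lemma energy_derivative l u (d : R) : 0 <= l -> H1 u ->
  has_energy_derivative p ainf binf a b l u u d <-> fine (Qf l u) - fine (Bf u) = d.
Proof.
move=> l0 Hu; have su := H1_sqint Hu.
suff h : has_energy_derivative p ainf binf a b l u u (fine (Qf l u) - fine (Bf u)).
  split=> [h'|<-//].
  by have := @derive_val _ _ _ _ _ _ _ h; have := @derive_val _ _ _ _ _ _ _ h';
    move=> <- <-.
pose f (t : R) := 2^-1 * ((1 + t) ^+ 2 * fine (Qf l u)) - q^-1 * ((1 + t) `^ q * fine
  (Bf u)).
apply: (@near_eq_is_derive _ _ _ f).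
  near=> t; have t0 : 0 < 1 + t.
    rewrite -ltrBlDl sub0r; near: t; apply: lt_nbhsr.
    by rewrite ltrN10.
  rewrite (_ : (fun x => u x + t * u x) = (fun x => (1 + t) * u x)); last first.
    by apply/funext => x; rewrite mulrDl mul1r.
  rewrite energyE//; last exact: H1Z.
  rewrite QfZ// BfZ//; [|exact: su.1|exact: ltW].
  by rewrite /f !fine_mulpos ?powR_gt0 ?exprn_gt0.
have d1 : is_derive (0 : R) 1 (fun t : R => 1 + t) 1.
  apply: is_derive_congr (is_deriveD (is_derive_cst (1 : R) (0 : R) (1 : R)) (is_derive_id
    (0 : R) (1 : R))) _ _ => //.
  by rewrite add0r.
have d2 : is_derive (0 : R) 1 (fun t : R => (1 + t) `^ q) (q * 1).
  have dp : is_derive (1 + 0 : R) 1 (@powR R ^~ q) (q * 1).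
    rewrite addr0; have := @is_derive1_powR R q 1 ltr01.
    by rewrite powR1.
  apply: is_derive_congr (@is_derive1_comp _ (@powR R ^~ q) (fun t : R => 1 + t) 0 _ _ dp
    d1) _ _ => //.
  by rewrite mulr1.
have d3 := @is_deriveX _ _ _ 2 _ _ _ d1.
have dZ (k l1 : R) (g : R -> R) : is_derive (0 : R) 1 g l1 ->
    is_derive (0 : R) 1 (fun t => k * g t) (k * l1) by move=> dg; exact: is_deriveZ.
have d4 := dZ (2^-1 * fine (Qf l u)) _ _ d3.
have d5 := dZ (q^-1 * fine (Bf u)) _ _ d2.
apply: is_derive_congr (is_deriveB d4 d5) _ _.
  by move=> t; rewrite /f /GRing.scale/= !fctE/=; ring.
by rewrite /GRing.scale/= addr0 expr1 !mulr1; field; rewrite gt_eqF.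
Unshelve. all: by end_near. Qed.

Lemma nehariP l u : 0 <= l -> nehari p ainf binf a b l u <->
  [/\ H1 u, ~ (u = cst 0 %[ae mu]) & fine (Qf l u) = fine (Bf u)].
Proof.
move=> l0; split=> -[Hu u0 h]; split => //.
  by apply/eqP; rewrite -subr_eq0; apply/eqP/energy_derivative.
by apply/energy_derivative => //; rewrite h subrr.
Qed.

(** The norm with exponent [+oo] unfolds to the essential supremum under the condition that the
    total mass is positive. *)
Lemma lebesgue_rV_gt0 : (0 < mu [set: 'rV[R]_N])%E.
Proof.
have v0 : (0 < mu (cube (1 : R)))%E.
  have := vol_cube (N := N) (@ltr01 R); rewrite integral_indic//;
    last exact: measurable_cubeE.
  by rewrite setIT => ->; rewrite lte_fin vol_gt0.
apply: lt_le_trans v0 _; apply: (le_measure mu) => //; rewrite inE//.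
exact: measurable_cubeE.
Qed.

Lemma b_bounded : exists2 C, 0 <= C & {ae mu, forall x, `|b x| <= C}.
Proof.
have : (Lnorm mu +oo (EFin \o b) < +oo)%E.
  by move: b_Loo; rewrite inE => /andP[_]; rewrite inE.
rewrite unlock lebesgue_rV_gt0 => h.
have [C hC] : exists C : R, (ess_sup mu (abse \o (EFin \o b)) <= C%:E)%E.
  case E : (ess_sup mu (abse \o (EFin \o b))) h => [C| |]// _; first by exists C.
  by exists 0; rewrite leNye.
exists (Num.max C 0); first by rewrite le_max lexx orbT.
have := @ess_sup_ge _ _ _ mu (abse \o (EFin \o b)).
apply: filterS => x /= hx; have := le_trans hx hC; rewrite lee_fin => hb.
by rewrite le_max hb.
Qed.

(** A bounded square-integrable function satisfies [|v| ^ (p + 1) <= M ^ (p - 1) * v ^ 2]. *)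
Lemma Bf_lty v M : sqint mu v -> (forall x, `|v x| <= M) -> (Bf v < +oo)%E.
Proof.
move=> sv vM; have [C C0 bC] := b_bounded.
have M0 : 0 <= M by apply: le_trans (vM 0).
apply: (@le_lt_trans _ _ (\int[mu]_x (((binf + C) * M `^ (p - 1))%:E * (v x ^+ 2)%:E)))%E;
  last first.
  rewrite ge0_integralZl//.
  - by rewrite (nrm2E sv) -EFinM ltry.
  - by apply/measurable_EFinP; apply: measurable_funX; exact: sv.1.
  - by move=> x _; rewrite lee_fin sqr_ge0.
  - by rewrite lee_fin mulr_ge0 ?powR_ge0// addr_ge0// ltW.
apply: ae_ge0_le_integral => //.
- by move=> x _; rewrite lee_fin mulr_ge0 ?powR_ge0// addr_ge0// ltW.
- exact: measurable_Bint sv.1.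
- by move=> x _; rewrite -EFinM lee_fin mulr_ge0 ?sqr_ge0// mulr_ge0 ?powR_ge0//
  addr_ge0// ltW.
- apply: measurable_funeM.
  by apply/measurable_EFinP; apply: measurable_funX; exact: sv.1.
- move: bC; apply: filterS => x bx _; rewrite -EFinM lee_fin -mulrA.
  apply: ler_pM; rewrite ?powR_ge0 ?addr_ge0 ?(ltW binf_gt0) ?lerD2l//.
  rewrite (_ : q = (p - 1) + 2); last by rewrite /q; ring.
  rewrite powRD; last by rewrite implybE gt_eqF// ltr_wpDl// subr_ge0 ltW.
  have -> : `|v x| `^ 2 = v x ^+ 2 by rewrite powR_mulrn// real_normK ?num_real.
  rewrite ler_wpM2r ?sqr_ge0//.
  by apply: ge0_ler_powR; rewrite ?nnegrE// subr_ge0 ltW.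
Qed.

(* [a] is integrated against bounded functions by [|a| <= 1 + |a|^(N/2)]. *)
Lemma Af_lty v M : sqint mu v -> (forall x, `|v x| <= M) -> (Af v < +oo)%E.
Proof.
move=> sv vM; have M0 : 0 <= M by apply: le_trans (vM 0).
have N1 : 1 <= N%:R / 2 :> R by rewrite ler_pdivlMr// mul1r ler_nat.
have ia := Lfun_integrable N1 a_Lp.
have mpa : measurable_fun setT (fun x => (`|a x| `^ (N%:R / 2))%:E)
  by exact: measurable_int ia.
have aoo : (\int[mu]_x (`|a x| `^ (N%:R / 2))%:E < +oo)%E.
  have /integrableP[_] := ia.
  by under eq_integral do rewrite gee0_abs ?lee_fin ?powR_ge0//.
apply: (@le_lt_trans _ _ (\int[mu]_x ((v x ^+ 2)%:E + (M ^+ 2)%:E *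
  (`|a x| `^ (N%:R / 2))%:E)))%E; last first.
  rewrite ge0_integralD//; last 4 first.
  - by move=> x _; rewrite lee_fin sqr_ge0.
  - by apply/measurable_EFinP; apply: measurable_funX; exact: sv.1.
  - by move=> x _; rewrite -EFinM lee_fin mulr_ge0 ?sqr_ge0 ?powR_ge0.
  - exact: measurable_funeM.
  rewrite ge0_integralZl//.
  - rewrite (nrm2E sv) lte_add_pinfty ?ltry// lte_mul_pinfty// ?lee_fin ?sqr_ge0//.
  - by rewrite lee_fin sqr_ge0.
apply: ge0_le_integral => //.
- by move=> x _; rewrite lee_fin mulr_ge0 ?sqr_ge0.
- exact: measurable_Aint sv.1.
- apply: emeasurable_funD; last exact: measurable_funeM.
  by apply/measurable_EFinP; apply: measurable_funX; exact: sv.1.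
- move=> x _; rewrite -EFinM -EFinD lee_fin.
  have v2 : v x ^+ 2 <= M ^+ 2.
    by rewrite -[v x ^+ 2]real_normK ?num_real// ler_pXn2r ?nnegrE.
  have [a1|a1] := leP `|a x| 1.
    rewrite -[leLHS]addr0 lerD ?mulr_ge0 ?sqr_ge0 ?powR_ge0//.
    by rewrite -[leRHS]mul1r ler_wpM2r ?sqr_ge0.
  rewrite -[leLHS]add0r lerD ?sqr_ge0// mulrC.
  apply: ler_pM => //; first exact: sqr_ge0.
  by rewrite -{1}(powRr1 (normr_ge0 _)) ler_powR// ltW.
Qed.

(* The approximants are averages of [u] over small cubes: they are bounded, averaging
   commutes with weak derivatives and decreases L^2 norms, and [Bf] is controlled from
   below by Fatou's lemma. *)
Lemma bounded_approximation u K : H1 u -> 0 <= K -> (K%:E < Bf u)%E ->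
  exists v, [/\ H1 v, (Af v < +oo)%E, (Bf v < +oo)%E, (Gf v <= Gf u)%E & (K%:E < Bf v)%E].
Proof.
move=> Hu K0 KB; have su := H1_sqint Hu.
(* The radii are chosen so that the squared L^2 error of the [n]-th average is at most [2^-n], which
   makes the averages converge almost everywhere, as Fatou's lemma needs. *)
have /choice[r rP] (n : nat) : exists r : R, 0 < r /\
    forall y, cube r y -> nrm2 mu (fun x => u (x + y) - u x) <= 2^-1 ^+ n.
  have e0 : 0 < (2^-1 : R) ^+ n by rewrite exprn_gt0// invr_gt0.
  have [r r0 rn] := translation_continuous su e0.
  by exists r.
pose v n := avg (r n) u.
have sv n : sqint mu (v n) := (avg_sqint (rP n).1 su).1.
have vb n x : `|v n x| <= Num.sqrt ((@vol R N (r n))^-1 * nrm2 mu u).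
  rewrite -sqrtr_sqr ler_sqrt.
    exact: (avg_bounded (rP n).1).
  by rewrite mulr_ge0 ?nrm2_ge0// invr_ge0 ltW// vol_gt0// (rP n).1.
have sg n i := avg_sqint (rP n).1 (wgradP i Hu).1.
have wg n i : weak_partial i (v n) (avg (r n) (wgrad u i)).
  by apply: avg_weak_partial => //; [exact: (rP n).1|exact: (wgradP i Hu).1|exact: (wgradP
    i Hu).2].
have Hv n : H1 (v n) by exact: (H1I (sv n) (fun i => (sg n i).1) (wg n)).
have GG n : (Gf (v n) <= Gf u)%E.
  rewrite (GfE (sv n) (fun i => (sg n i).1) (wg n)) GfH1// lee_fin lerD//.
    by apply: ler_sum => i _; exact: (sg n i).2.
  by rewrite ler_pM2l//; exact: (avg_sqint (rP n).1 su).2.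
have [n Kn] : exists n, (K%:E < Bf (v n))%E.
  apply: contrapT => /forallNP h; move: KB; apply/negP; rewrite -leNgt.
  have cv : {ae mu, forall x, (fun n => v n x - u x) @ \oo --> (0 : R)}.
    apply: (@fast_sq_cvg_ae _ _ _ _ (fun n x => v n x - u x)) => n.
      exact: sqintB.
    exact: (avg_close (rP n).1 su (rP n).2).
  have mBv n : measurable_fun setT (fun x => ((binf + `|b x|) * `|v n x| `^ q)%:E).
    exact: measurable_Bint (sv n).1.
  have B0 n x : (0 <= ((binf + `|b x|) * `|v n x| `^ q)%:E)%E.
    by rewrite lee_fin mulr_ge0 ?powR_ge0// addr_ge0// ltW.
  have := fatou mu measurableT mBv (fun n x _ => B0 n x).
  have -> : (\int[mu]_x limn_einf (fun n => ((binf + `|b x|) * `|v n x| `^ q)%:E) =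
    Bf u)%E.
    apply: ae_eq_integral => //.
    - by apply: measurableT_comp => //; apply: measurable_fun_limn_esup => n;
      exact: measurableT_comp.
    - exact: measurable_Bint su.1.
    - move: cv; apply: filterS => x vx _.
      apply: (cvg_limn_einf_sup _).1; apply: cvg_EFin; first exact: nearW.
      apply: cvgMr.
      have vu : (fun n => `|v n x|) @ \oo --> `|u x|.
        apply: cvg_norm; rewrite -[X in _ --> X](addr0 (u x)).
        rewrite (_ : (fun n => v n x) = (fun n => u x + (v n x - u x))); last first.
          by apply/funext => n; rewrite addrC subrK.
        by apply: cvgD => //; exact: cvg_cst.
      exact: powR_cvg.
  move=> /le_trans; apply.
  rewrite limn_einf_lim; apply: lime_le.
    apply: is_cvg_einfs.
  apply: nearW => n; apply: (@le_trans _ _ (Bf (v n))).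
    by apply: ereal_inf_lbound; exists n => /=.
  by rewrite leNgt; apply/negP; exact: h.
exists (v n); split => //.
- exact: (Af_lty (sv n) (vb n)).
- exact: (Bf_lty (sv n) (vb n)).
Qed.

End functional.

(** * Continuity of the ground level *)

Section fibering.
Context {R : realType}.
Variable p : R.
Hypothesis p_gt1 : 1 < p.
Implicit Types (Q B d : R).

Let r := 2 / (p - 1).
Let r_gt0 : 0 < r. Proof. by rewrite divr_gt0// subr_gt0. Qed.

Definition theta : R := 2^-1 - (p + 1)^-1.

Lemma theta_gt0 : 0 < theta.
Proof.
rewrite subr_gt0 ltf_pV2 ?posrE//; last by rewrite addr_gt0// (lt_trans _ p_gt1).
by rewrite -ltrBlDr (_ : 2 - 1 = 1 :> R)//; ring.
Qed.

(* The maximum over t > 0 of t^2 Q / 2 - t^(p+1) B / (p+1). *)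
Definition fiber_level Q B : R := theta * (Q / B) `^ (2 / (p - 1)) * Q.

Lemma fiber_level_ge0 Q B : 0 <= Q -> 0 <= fiber_level Q B.
Proof. by move=> Q0; rewrite mulr_ge0// mulr_ge0 ?powR_ge0// ltW// theta_gt0. Qed.

Lemma fiber_level_le Q Q' B B' : 0 <= Q -> Q <= Q' -> 0 < B' -> B' <= B ->
  fiber_level Q B <= fiber_level Q' B'.
Proof.
move=> Q0 QQ' B'0 BB'; have B0 := lt_le_trans B'0 BB'; have Q'0 := le_trans Q0 QQ'.
apply: ler_pM => //.
  by rewrite mulr_ge0 ?powR_ge0// ltW// theta_gt0.
rewrite ler_pM2l ?theta_gt0//.
have h : Q / B <= Q' / B'.
  by apply: ler_pM => //; [rewrite invr_ge0 ltW|rewrite lef_pV2].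
by apply: (ge0_ler_powR (ltW r_gt0) _ _ h); rewrite nnegrE divr_ge0// ltW.
Qed.

Lemma fiber_levelZl d Q B : 0 < d -> 0 <= Q -> 0 < B ->
  fiber_level (d * Q) B = d `^ (r + 1) * fiber_level Q B.
Proof.
move=> d0 Q0 B0; rewrite /fiber_level -(mulrA d Q) powRM ?(ltW d0) ?divr_ge0 ?(ltW B0)//.
rewrite powRD ?(gt_eqF d0) ?implybT// powRr1 ?(ltW d0)// -/r.
ring.
Qed.

Lemma fiber_levelZr d Q B : 0 < d -> 0 <= Q -> 0 < B ->
  fiber_level Q (B / d) = d `^ r * fiber_level Q B.
Proof.
move=> d0 Q0 B0; rewrite /fiber_level (_ : Q / (B / d) = d * (Q / B)); last first.
  by rewrite invf_div mulrCA.
rewrite powRM ?(ltW d0) ?divr_ge0 ?(ltW B0)//.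
by rewrite -/r; ring.
Qed.

(** On the Nehari set the two arguments coincide, so this identifies the energy there, [theta * Q],
    with a fiber level. *)
Lemma fiber_level_diag Q : 0 < Q -> fiber_level Q Q = theta * Q.
Proof. by move=> Q0; rewrite /fiber_level divff ?gt_eqF// powR1 mulr1. Qed.

Lemma fiber_critical Q B : 0 < Q -> 0 < B ->
  exists2 t, 0 < t & t ^+ 2 * Q = t `^ (p + 1) * B /\
    2^-1 * (t ^+ 2 * Q) - (p + 1)^-1 * (t `^ (p + 1) * B) = fiber_level Q B.
Proof.
move=> Q0 B0; have p1 : 0 < p - 1 by rewrite subr_gt0.
have QB0 : 0 < Q / B by exact: divr_gt0.
(* The positive solution of [t ^ (p - 1) * B = Q], the critical point along the ray. *)
pose t := (Q / B) `^ (p - 1)^-1.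
have t0 : 0 < t by exact: powR_gt0.
have t2 : t ^+ 2 = (Q / B) `^ r.
  by rewrite -powR_mulrn ?(ltW t0)// /t -powRrM (mulrC _ 2%:R).
have tp : t `^ (p - 1) = Q / B by rewrite /t -powRrM mulVf ?gt_eqF// powRr1// ltW.
have E : t ^+ 2 * Q = t `^ (p + 1) * B.
  rewrite (_ : p + 1 = (p - 1) + 2); last by ring.
  rewrite powRD ?(gt_eqF t0) ?implybT// tp powR_mulrn ?(ltW t0)//.
  by field; rewrite gt_eqF.
exists t => //; split => //; rewrite -E /fiber_level -/r -t2 /theta.
ring.
Qed.

End fibering.

(** * The infimum over the Nehari set as a function of the parameter *)

Section level.
Context {R : realType} (N : nat).
Let mu := lebesgue_rV R N.
Variables (p ainf binf : R) (a b : 'rV[R]_N -> R).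
Hypothesis N_ge2 : (2 <= N)%N.
Hypothesis p_gt1 : 1 < p.
Hypothesis ainf_gt0 : 0 < ainf.
Hypothesis binf_gt0 : 0 < binf.
Hypothesis a_Lp : a \in Lfun mu (N%:R / 2)%:E.
Hypothesis a_ge0 : {ae mu, forall x, 0 <= a x}.
Hypothesis b_Loo : b \in Lfun mu +oo%E.
Hypothesis b_ge0 : {ae mu, forall x, 0 <= b x}.
Implicit Types (u v : 'rV[R]_N -> R) (l : R).

Let G u := Gf ainf u.
Let A u := Af a u.
Let B u := Bf p binf b u.
Let Q l u := Qf ainf a l u.
Let E l u := energy p ainf binf a b l u.
Let nh l := nehari p ainf binf a b l.
Let m l := ground_level p ainf binf a b l.
Let J := fiber_level p.

Let G_real u : H1 u -> ~ (u = cst 0 %[ae mu]) -> exists2 g : R, 0 < g & G u = g%:E.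
Proof.
move=> Hu u0; have := Gf_gt0 ainf_gt0 Hu u0; rewrite /G (GfH1 ainf_gt0 Hu) lte_fin.
by move=> g0; eexists; first exact: g0.
Qed.

Let A_real u : (A u < +oo)%E -> exists2 x : R, 0 <= x & A u = x%:E.
Proof.
move=> Aoo; have A0 : (0 <= A u)%E := Af_ge0 a u.
have Af : A u \is a fin_num by rewrite ge0_fin_numE.
by exists (fine (A u)); [exact: fine_ge0|rewrite fineK].
Qed.

Let B_gt0 u : H1 u -> ~ (u = cst 0 %[ae mu]) -> (0 < B u)%E.
Proof. by move=> Hu; apply: (Bf_gt0 p binf_gt0 b_Loo); exact: (H1_sqint Hu).1. Qed.

Let B_real u : H1 u -> ~ (u = cst 0 %[ae mu]) -> (B u < +oo)%E ->
  exists2 x : R, 0 < x & B u = x%:E.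
Proof.
move=> Hu u0 Boo; have B0 := B_gt0 Hu u0.
have Bf : B u \is a fin_num by rewrite ge0_fin_numE// ltW.
by exists (fine (B u)); [rewrite fine_gt0// B0|rewrite fineK].
Qed.

Let nhP l u : 0 <= l -> nh l u <->
  [/\ H1 u, ~ (u = cst 0 %[ae mu]) & fine (Q l u) = fine (B u)].
Proof. exact: nehariP. Qed.

Let EE l u : 0 <= l -> H1 u -> E l u = 2^-1 * fine (Q l u) - (p + 1)^-1 * fine (B u).
Proof. exact: energyE. Qed.

(* In the second case both real-valued integrals of [energy] take the junk value 0. *)
Lemma nehari_dichotomy l u : 0 <= l -> nh l u ->
  (exists g x, [/\ 0 < g, 0 < x, Q l u = g%:E, B u = x%:E & E l u = J g x]) \/
  [/\ Q l u = +oo%E, B u = +oo%E & E l u = 0].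
Proof.
move=> l0 /(nhP _ l0)[Hu u0 h]; rewrite EE// -h.
have [g g0 Gg] := G_real Hu u0; have B0 := B_gt0 Hu u0.
have Q0 : (g%:E <= Q l u)%E.
  by rewrite /Q /Qf -/(G u) Gg leeDl// mule_ge0 ?Af_ge0// lee_fin.
case EQ : (Q l u) Q0 h => [k| |]//=.
  rewrite lee_fin => gk kB; have k0 := lt_le_trans g0 gk; left.
  have BB : B u = k%:E by move: kB k0 B0; case: (B u) => [x /= ->|/= -> |]//;
    rewrite ltxx.
  exists k, k; split => //.
  by rewrite /J fiber_level_diag// /theta mulrBl.
move=> _ hB; right; split => //; last by rewrite !mulr0 subrr.
by move: hB B0; case: (B u) => [x /= <-|//|]//; rewrite ltxx.
Qed.

Let E_ge0 l u : 0 <= l -> nh l u -> 0 <= E l u.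
Proof.
move=> l0 /(nehari_dichotomy l0)[[g [x [g0 x0 _ _ ->]]]|[_ _ ->//]].
by apply: fiber_level_ge0 => //; exact: ltW.
Qed.

Let S l := [set E l u | u in nh l].

Let S_lb l : 0 <= l -> lbound (S l) 0.
Proof. by move=> l0 _ [u nu <-]; exact: E_ge0. Qed.

Lemma level_ge0 l : 0 <= l -> 0 <= m l.
Proof.
move=> l0; rewrite /m /ground_level -/(S l).
have [->|/set0P S0] := eqVneq (S l) set0; first by rewrite inf0.
by apply: lb_le_inf => //; exact: S_lb.
Qed.

(** The ray through [v] is followed to the critical [t] of [fiber_critical], where it meets the
    Nehari set with energy equal to the fiber level. *)
Lemma admissible_nehari v l g x y : 0 <= l -> H1 v -> ~ (v = cst 0 %[ae mu]) ->
  G v = g%:E -> A v = x%:E -> B v = y%:E -> S l (J (g + l * x) y).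
Proof.
move=> l0 Hv v0 Gg Ax By.
have g0 : 0 < g by have := Gf_gt0 ainf_gt0 Hv v0; rewrite -/(G v) Gg lte_fin.
have x0 : 0 <= x by have := Af_ge0 a v; rewrite -/(A v) Ax lee_fin.
have y0 : 0 < y by have := B_gt0 Hv v0; rewrite By lte_fin.
have Qg : Q l v = (g + l * x)%:E by rewrite /Q /Qf -/(G v) -/(A v) Gg Ax.
have Q0 : 0 < g + l * x by rewrite ltr_wpDr// mulr_ge0.
have [t t0 [tE tJ]] := fiber_critical p_gt1 Q0 y0.
have mv := (H1_sqint Hv).1.
have Htv : H1 (fun z => t * v z) by exact: H1Z.
have QE : Q l (fun z => t * v z) = (t ^+ 2 * (g + l * x))%:E.
  by rewrite /Q QfZ// -/(Q l v) Qg.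
have BE : B (fun z => t * v z) = (t `^ (p + 1) * y)%:E.
  by rewrite /B BfZ ?(ltW t0)// -/(B v) By.
exists (fun z => t * v z); last by rewrite EE// QE BE.
apply/nhP => //; split => //; last by rewrite QE BE.
move=> tv0; apply: v0; move: tv0; apply: filterS => z /(_ I)/eqP.
by rewrite mulf_eq0 gt_eqF//= => /eqP vz _.
Qed.

Lemma level_le v l g x y : 0 <= l -> H1 v -> ~ (v = cst 0 %[ae mu]) ->
  G v = g%:E -> A v = x%:E -> B v = y%:E -> m l <= J (g + l * x) y.
Proof.
move=> l0 Hv v0 Gg Ax By; apply: ge_inf; first by exists 0; exact: S_lb.
exact: (admissible_nehari l0 Hv v0 Gg Ax By).
Qed.

Let approx u k : H1 u -> ~ (u = cst 0 %[ae mu]) -> 0 <= k -> (k%:E < B u)%E ->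
  exists v g x y, [/\ H1 v, ~ (v = cst 0 %[ae mu]), [/\ G v = g%:E, A v = x%:E & B v =
    y%:E],
    (g%:E <= G u)%E /\ 0 < g & k < y].
Proof.
move=> Hu u0 k0 kB.
have [v [Hv Av Bv GG kBv]] := bounded_approximation N_ge2 p_gt1 ainf_gt0 binf_gt0 a_Lp
  b_Loo Hu k0 kB.
have v0 : ~ (v = cst 0 %[ae mu]).
  move=> v0; move: kBv; rewrite (Bf_eq0 _ p_gt1 b_Loo (H1_sqint Hv).1 v0).
  by rewrite lte_fin ltNge k0.
have [g g0 Gg] := G_real Hv v0; have [x x0 Ax] := A_real Av.
have [y y0 By] := B_real Hv v0 Bv.
exists v, g, x, y; split => //; first by rewrite -Gg.
by move: kBv; rewrite -/(B v) By lte_fin.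
Qed.

Let r := 2 / (p - 1).
Let r_gt0 : 0 < r. Proof. by rewrite divr_gt0// subr_gt0. Qed.

(* Such a [u] is excluded by the Sobolev embedding, but its existence would do no harm:
   it lies on the Nehari set of every [l > 0] with energy 0, and its bounded
   approximants give [m 0 = 0]. *)
Lemma level_eq0 u l : 0 <= l -> H1 u -> A u = +oo%E -> B u = +oo%E -> m l = 0.
Proof.
move=> l0 Hu Au Bu.
have u0 : ~ (u = cst 0 %[ae mu]).
  by move=> u0; move: Bu; rewrite /B (Bf_eq0 _ p_gt1 b_Loo (H1_sqint Hu).1 u0).
have [g g0 Gg] := G_real Hu u0.
apply/eqP; rewrite eq_le level_ge0// andbT.
have [->|{}l0] : l = 0 \/ 0 < l.
  by move: l0; rewrite le_eqVlt => /predU1P[<-|]; [left|right].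
2: {
  have QE : Q l u = +oo%E.
    by rewrite /Q /Qf -/(G u) -/(A u) Gg Au gt0_muley ?lte_fin.
  have nu : nh l u by apply/nhP; [exact: ltW|split => //; rewrite QE Bu].
  apply: ge_inf; first by exists 0; apply: S_lb; exact: ltW.
  by exists u => //; rewrite -/(E l u) EE ?(ltW l0)// QE Bu !mulr0 subrr. }
rewrite leNgt; apply/negP => m0.
(* Chosen so that [J g (g / d) = d ^ r * theta * g = m 0 / 2]. As [B u] is infinite, some
   approximant has [B] above [g / d] and [G] at most [g], hence a level below [m 0]. *)
pose d := (m 0 / (theta p * g) / 2) `^ r^-1.
have tg : 0 < theta p * g by rewrite mulr_gt0 ?theta_gt0.
have mm : 0 < m 0 / (theta p * g) / 2 by rewrite divr_gt0// divr_gt0.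
have d0 : 0 < d by exact: powR_gt0.
have k0 : 0 < g / d by exact: divr_gt0.
have [|v [g' [x [y [Hv v0 [Gv Av Bv] [gg g'0] ky]]]]] := approx Hu u0 (ltW k0);
  first by rewrite Bu ltry.
have := level_le (lexx 0) Hv v0 Gv Av Bv; rewrite mul0r addr0.
apply/negP; rewrite -ltNge.
apply: (@le_lt_trans _ _ (J g (g / d))).
  apply: fiber_level_le => //; [exact: ltW| |exact: ltW].
  by rewrite -lee_fin -Gg.
rewrite /J fiber_levelZr ?(ltW g0)// fiber_level_diag// -/r -powRrM mulVf ?gt_eqF// powRr1
  ?(ltW mm)//.
by rewrite mulrAC divfK ?gt_eqF// ltr_pdivrMr// mulr_natr mulr2n ltrDl.
Qed.

Section finite_level.
Hypothesis finite_u : forall u, H1 u -> ~ (A u = +oo%E /\ B u = +oo%E).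

(** For [l > 0], an infinite [A u] forces [Q l u], and then [B u] by the Nehari condition, to be
    infinite, against [finite_u]. At [l = 0] this breaks down, since [0 * A u] is 0 even when [A u]
    is infinite. *)
Let nh_J l u : 0 < l -> nh l u -> exists g x y,
  [/\ H1 u, ~ (u = cst 0 %[ae mu]), [/\ G u = g%:E, A u = x%:E & B u = y%:E],
    [/\ 0 < g, 0 <= x & 0 < y] & E l u = J (g + l * x) y].
Proof.
move=> l0 nu; have [Hu u0 _] := (nhP u (ltW l0)).1 nu.
have [g g0 Gg] := G_real Hu u0.
have [Au|/eqP] := eqVneq (A u) +oo%E.
  have QE : Q l u = +oo%E.
    by rewrite /Q /Qf -/(G u) -/(A u) Gg Au gt0_muley ?lte_fin.
  case: (nehari_dichotomy (ltW l0) nu) => [[k [x [_ _]]]|[_ Bu _]]; first by rewrite QE.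
  by case: (finite_u Hu).
move/eqP; rewrite -ltey => /A_real[x x0 Ax].
have QE : Q l u = (g + l * x)%:E by rewrite /Q /Qf -/(G u) -/(A u) Gg Ax.
case: (nehari_dichotomy (ltW l0) nu) => [[k [y [k0 y0 Qk By EJ]]]|[]]; last by rewrite QE.
exists g, x, y; split => //; rewrite EJ.
by move: Qk; rewrite QE => -[->].
Qed.

(** A comparison of fiber levels, uniform in the three integrals, passes to infima: a Nehari
    function for [k] is rescaled onto the Nehari set for [l]. Nonemptiness is required because
    [inf set0] is 0. *)
Lemma level_le_of_nonempty k l : 0 < k -> 0 <= l -> S k !=set0 -> forall c, 0 <= c ->
  (forall g x y, 0 < g -> 0 <= x -> 0 < y -> c * J (g + l * x) y <= J (g + k * x) y) ->
  c * m l <= m k.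
Proof.
move=> k0 l0 S0 c c0 h; apply: lb_le_inf => // _ [u nu <-].
have [g [x [y [Hu u0 [Gg Ax By] [g0 x0 y0] EJ]]]] := nh_J k0 nu.
rewrite -/(E k u) EJ; apply: le_trans (h g x y g0 x0 y0).
by rewrite ler_wpM2l// (level_le l0 Hu u0 Gg Ax By).
Qed.

Lemma level_homo k l : 0 <= l -> l <= k -> S k !=set0 -> m l <= m k.
Proof.
rewrite le_eqVlt => /predU1P[<-|l0 lk S0]; last first.
  rewrite -[m l]mul1r; apply: level_le_of_nonempty => //;
    [exact: lt_le_trans lk|exact: ltW|].
  move=> g x y g0 x0 y0; rewrite mul1r; apply: fiber_level_le => //.
    by rewrite addr_ge0 ?mulr_ge0 ?(ltW g0) ?(ltW l0).
  by rewrite lerD2l ler_wpM2r.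
rewrite le_eqVlt => /predU1P[<-//|k0 S0].
rewrite -[m 0]mul1r; apply: level_le_of_nonempty => // g x y g0 x0 y0.
rewrite mul1r; apply: fiber_level_le => //.
  by rewrite mul0r addr0 ltW.
by rewrite lerD2l ler_wpM2r// ltW.
Qed.

(* [g + k x >= (k / l) (g + l x)], and [fiber_level] is homogeneous of degree [r + 1] in
   its first argument. *)
Lemma level_scale k l : 0 < k -> k <= l -> S k !=set0 -> (k / l) `^ (r + 1) * m l <= m k.
Proof.
move=> k0 kl S0; have l0 := lt_le_trans k0 kl.
apply: level_le_of_nonempty => //; [exact: ltW|exact: powR_ge0|].
move=> g x y g0 x0 y0; rewrite -fiber_levelZl//; last 2 first.
- exact: divr_gt0.
- by rewrite addr_ge0 ?mulr_ge0 ?(ltW g0) ?(ltW l0).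
apply: fiber_level_le => //.
  by rewrite mulr_ge0 ?divr_ge0 ?addr_ge0 ?mulr_ge0 ?(ltW g0) ?(ltW l0) ?(ltW k0).
rewrite mulrDr mulrA divfK ?gt_eqF// lerD2r.
by rewrite ler_piMl ?(ltW g0)// ler_pdivrMr// mul1r.
Qed.

(** A near-minimiser [u] at 0 is replaced by a bounded [v] with [G v <= G u] and [B v] above
    [B u / d], where [d > 1] is close to 1. Since [A v] is finite, the term [l * A v] is harmless
    for small [l]. *)
Lemma level_right0 e : 0 < e -> S 0 !=set0 ->
  exists2 d, 0 < d & forall l, 0 <= l -> l <= d -> m l <= m 0 + e.
Proof.
move=> e0 S0.
have [_ [u nu <-] us] := inf_adherent e0 (conj S0 (ex_intro _ 0 (S_lb (lexx 0)))).
have [Hu u0 _] := (nhP u (lexx 0)).1 nu.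
have [gu gu0 Gg] := G_real Hu u0.
have QE : Q 0 u = gu%:E by rewrite /Q /Qf -/(G u) mul0e adde0.
case: (nehari_dichotomy (lexx 0) nu) => [[k [y [k0 y0 Qk By EJ]]]|[]]; last by rewrite QE.
move: Qk; rewrite QE => -[gk]; rewrite -gk in EJ.
set s := E 0 u in EJ; have {}us : s < m 0 + e by exact: us.
have s0 : 0 < s by rewrite EJ /J /fiber_level !mulr_gt0 ?theta_gt0 ?powR_gt0 ?divr_gt0.
(* Multiplying the first argument of [J] by [d] and dividing the second by [d] costs
   [d ^ (r + 1) * d ^ r]; this [d] makes the product with [s] equal to [m 0 + e]. *)
pose d := ((m 0 + e) / s) `^ (r + 1 + r)^-1.
have rr : 0 < r + 1 + r by rewrite !addr_gt0.
have ms : 1 < (m 0 + e) / s by rewrite ltr_pdivlMr// mul1r.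
have d1 : 1 < d.
  suff : 1 `^ (r + 1 + r)^-1 < d by rewrite powR1.
  by apply: gt0_ltr_powR; rewrite ?invr_gt0 ?nnegrE// ltW// (lt_trans _ ms).
have d0 : 0 < d by apply: lt_trans d1.
have yd : y / d < y by rewrite ltr_pdivrMr// ltr_pMr.
have [|v [g [x [z [Hv v0 [Gv Av Bv] [gg g0] kz]]]]] := approx Hu u0
  (ltW (divr_gt0 y0 d0)).
  by rewrite By lte_fin.
have x0 : 0 <= x by have := Af_ge0 a v; rewrite -/(A v) Av lee_fin.
have ggu : g <= gu by rewrite -lee_fin -Gg.
(* For such [l], [g + l * x <= gu + (d - 1) * gu = d * gu]; the denominator [x + 1] avoids a
   division by zero. *)
exists ((d - 1) * gu / (x + 1)).
  by rewrite divr_gt0 ?mulr_gt0 ?subr_gt0// ltr_wpDl.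
move=> l l0 ld; apply: le_trans (level_le l0 Hv v0 Gv Av Bv) _.
apply: (@le_trans _ _ (J (d * gu) (y / d))).
  apply: fiber_level_le => //.
  - by rewrite addr_ge0 ?mulr_ge0 ?(ltW g0).
  - have : l * (x + 1) <= (d - 1) * gu by rewrite -ler_pdivlMr// ltr_wpDl.
    by move: l0 ggu; nra.
  - exact: divr_gt0.
  - exact: ltW.
rewrite /J fiber_levelZl ?(ltW gu0) ?divr_gt0// fiber_levelZr ?(ltW gu0)//.
rewrite mulrA -powRD ?(gt_eqF d0) ?implybT// -/J -EJ -/r -powRrM mulVf ?gt_eqF//.
by rewrite powRr1 ?divfK ?gt_eqF// ltW// (lt_trans _ ms).
Qed.

Lemma level_continuous_at l0 e : 0 <= l0 -> 0 < e ->
  (forall l, 0 <= l -> S l !=set0) ->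
  \forall l \near l0, 0 <= l -> `|m l0 - m l| <= e.
Proof.
move=> l00 e0 S0.
have [->|{}l00] : l0 = 0 \/ 0 < l0.
  by move: l00; rewrite le_eqVlt => /predU1P[<-|]; [left|right].
  have [d d0 dP] := level_right0 e0 (S0 0 (lexx 0)).
  near=> l => l1.
  have h1 : m 0 <= m l by apply: level_homo => //; exact: S0.
  have h2 : m l <= m 0 + e.
    by apply: dP => //; apply: ltW; near: l; exact: lt_nbhsl.
  by rewrite distrC ger0_norm ?subr_ge0// lerBlDl.
have m00 : 0 <= m l0 by apply: level_ge0; exact: ltW.
have fc : (fun l => (l / l0) `^ (r + 1)) @ l0 --> (1 : R).
  have [/derivable1_diffP/differentiable_continuous c _] := is_derive1_powR (r + 1)
    (@ltr01 R).
  have h : (fun l : R => l / l0) @ l0 --> (1 : R).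
    by rewrite -(divff (lt0r_neq0 l00)); apply: cvgMl; exact: cvg_id.
  by have := cvg_comp _ _ h c; rewrite /comp/= powR1.
(* With [f = (l / l0) ^ (r + 1)], both sides of [l0] give a difference of at most [|1 - f| * m l0];
   the added 1 covers [m l0 = 0]. *)
have e1 : 0 < e / (m l0 + 1) by rewrite divr_gt0// ltr_wpDl.
move/cvgrPdist_le : fc => /(_ _ e1) fc.
near=> l => l1.
have l0' : 0 < l by near: l; exact: lt_nbhsr.
have : `|1 - (l / l0) `^ (r + 1)| <= e / (m l0 + 1) by near: l; exact: fc.
rewrite ler_norml ler_pdivlMr ?ltr_wpDl// -mulNr ler_pdivrMr ?ltr_wpDl// => /andP[f1 f2].
have [ll|ll] := leP l l0.
  have h1 : m l <= m l0 by apply: level_homo => //; exact: S0 (ltW _).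
  have h2 := level_scale l0' ll (S0 l l1).
  rewrite ger0_norm ?subr_ge0//.
  move: f2 h2 m00 e0; move: (_ `^ _) => f f2 h2 m00 e0.
  by have [?|?] := leP f 1; nra.
have h1 : m l0 <= m l by apply: level_homo; [exact: ltW|exact: ltW|exact: S0].
have h2 := level_scale l00 (ltW ll) (S0 l0 (ltW l00)).
(* The scaling inequality from [l0] to the larger [l], with its factor moved to the other side. *)
have h3 : m l <= (l / l0) `^ (r + 1) * m l0.
  have E1 : (l / l0) `^ (r + 1) * (l0 / l) `^ (r + 1) = 1.
    rewrite -powRM ?divr_ge0 ?(ltW l00)//.
    by rewrite mulrA divfK ?gt_eqF// divff ?gt_eqF// powR1.
  by have := ler_wpM2l (powR_ge0 (l / l0) (r + 1)) h2; rewrite mulrA E1 mul1r.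
rewrite distrC ger0_norm ?subr_ge0//.
move: f1 h3 m00 e0; move: (_ `^ _) => f f1 h3 m00 e0.
by have [?|?] := leP f 1; nra.
Unshelve. all: by end_near. Qed.

End finite_level.

Lemma level_continuous : {within [set l : R | 0 <= l], continuous m}.
Proof.
have cst_case : (forall l, 0 <= l -> m l = 0) -> {within [set l : R | 0 <= l], continuous
  m}.
  move=> m0; apply/subspace_continuousP => l /= l0; apply/cvgrPdist_le => e e0.
  rewrite near_withinE; apply: nearW => k k0.
  by change (is_true (`|m l - m k| <= e)); rewrite !m0// subrr normr0 ltW.
have [[u [Hu Au Bu]]|nou] := pselect (exists u, [/\ H1 u, A u = +oo%E & B u = +oo%E]).
  by apply: cst_case => l l0; exact: (level_eq0 l0 Hu Au Bu).
have fu u : H1 u -> ~ (A u = +oo%E /\ B u = +oo%E).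
  by move=> Hu [Au Bu]; apply: nou; exists u.
have [[v [g [x [y [Hv v0 [Gg Ax By]]]]]]|noadm] := pselect (exists v g x y,
    [/\ H1 v, ~ (v = cst 0 %[ae mu]) & [/\ G v = g%:E, A v = x%:E & B v = y%:E]]).
  have S0 l : 0 <= l -> S l !=set0.
    by move=> l0; eexists; exact: (admissible_nehari l0 Hv v0 Gg Ax By).
  apply/subspace_continuousP => l /= l0; apply/cvgrPdist_le => e e0.
  by rewrite near_withinE; exact: level_continuous_at.
(* Any Nehari function would have an approximant with [G], [A] and [B] all finite. With none
   available every Nehari set is empty and the level is [inf set0 = 0]. *)
apply: cst_case => l l0; rewrite /m /ground_level -/(S l).
suff -> : S l = set0 by rewrite inf0.
apply/seteqP; split => // e [u nu uE]; have [Hu u0 _] := (nhP u l0).1 nu.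
case: (approx Hu u0 (lexx 0) (B_gt0 Hu u0)) => v [g [x [y [Hv v0 h h1 h2]]]].
by case: noadm; exists v, g, x, y; split.
Qed.

End level.

Theorem proposition3p6 (R : realType) (N : nat) (p ainf binf : R)
    (a b : 'rV[R]_N -> R)
    (N_ge2 : (2 <= N)%N)
    (p_gt1 : 1 < p)
    (p_subcritical : (3 <= N)%N -> p < (N%:R + 2) / (N%:R - 2))
    (ainf_gt0 : 0 < ainf) (binf_gt0 : 0 < binf)
    (a_Lp : a \in Lfun (@lebesgue_rV R N) (N%:R / 2)%:E)
    (a_ge0 : {ae @lebesgue_rV R N, forall x, 0 <= a x})
    (a_neq0 : ~ (a = cst 0 %[ae @lebesgue_rV R N]))
    (a_infty : cvg0_at_infinity a)
    (b_Loo : b \in Lfun (@lebesgue_rV R N) +oo%E)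
    (b_ge0 : {ae @lebesgue_rV R N, forall x, 0 <= b x})
    (b_neq0 : ~ (b = cst 0 %[ae @lebesgue_rV R N]))
    (b_infty : cvg0_at_infinity b) :
  {within [set lambda : R | 0 <= lambda],
    continuous (fun lambda => ground_level p ainf binf a b lambda)}.
Proof.
exact: level_continuous.
Qed.
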